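(* Fix a possible pair of characteristics (characteristic of the field, characteristic of the residue field). The theory $\mathbf{ACVF}(L)$ of algebraically closed non-trivially valued fields with these fixed characteristics admits quantifier elimination in the two-sorted language $L$: every $L$-formula is equivalent, modulo $\mathbf{ACVF}(L)$, to a quantifier-free $L$-formula.
   Context: The two-sorted language is $L=(L_F,L_\Gamma,v)$. The field sort ($F$-sort) has language $L_F=\{0,1,+,-,\cdot\}$. The $\Gamma$-sort is interpreted as $\Gamma\cup\{\infty\}$, the value group with a last element, and its language $L_\Gamma$ consists of $\{0,\infty,+,-,<\}$ together with unary function symbols $\frac{\cdot}{q}$ (division by $q$) for each integer $q\geq 1$. The symbol $v$ is a function symbol from the $F$-sort to the $\Gamma$-sort, interpreted as the valuation (surjective onto $\Gamma\cup\{\infty\}$), with $v(0)=\infty$. The element $\infty$ is not in $\Gamma$, is larger than every element of $\Gamma$, is absorbing for addition, and by convention $a-\infty=0$ for all $a$. The models of $\mathbf{ACVF}(L)$ are the algebraically closed fields with a non-trivial valuation (so $\Gamma$ is a non-trivial divisible ordered abelian group) having the specified characteristic and residue characteristic. Formulas may contain quantifiers over both sorts and free variables of both sorts. *)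

(* Defs.v *)
From HB Require Import structures.
From mathcomp Require Import all_boot all_order all_algebra.
Set Implicit Arguments.
Unset Strict Implicit.
Unset Printing Implicit Defensive.
Import Order.TTheory GRing.Theory.
Local Open Scope ring_scope.

(* [Num.POrderedZmodule] only joins a partial order and a group law: totality
   and translation invariance have to be added to get an ordered group. *)
HB.mixin Record isOrderedGroup V of Num.POrderedZmodule V := {
  og_total : forall x y : V, (x <= y) || (y <= x);
  og_translate : forall z x y : V, x <= y -> x + z <= y + z
}.

#[short(type="orderedGroupType")]
HB.structure Definition OrderedGroup :=
  { V of Num.POrderedZmodule V & isOrderedGroup V }.

(* [option V] is V with a last element infinity, encoded by [None]. *)
Section ExtendedGroup.
Variable V : orderedGroupType.
Implicit Types a b : option V.

Definition eadd a b : option V :=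
  match a, b with
  | Some x, Some y => Some (x + y)
  | _, _ => None
  end.

(* a - infinity = 0 for every a, including a = infinity, whereas
   infinity - y = infinity + (- y) = infinity for y in V. *)
Definition esub a b : option V :=
  match a, b with
  | _, None => Some 0
  | None, Some _ => None
  | Some x, Some y => Some (x - y)
  end.

Definition elt a b : bool :=
  match a, b with
  | Some x, Some y => x < y
  | Some _, None => true
  | None, _ => false
  end.

Definition ele a b : bool := (a == b) || elt a b.

Definition emin a b : option V := if elt a b then a else b.

End ExtendedGroup.

Record valuedField := ValuedField {
  vf_field :> fieldType;
  vf_group : orderedGroupType;
  vf_val : vf_field -> option vf_group;
  val_eq_infty : forall x, vf_val x = None <-> x = 0;
  valM : forall x y, vf_val (x * y) = eadd (vf_val x) (vf_val y);
  valD : forall x y, ele (emin (vf_val x) (vf_val y)) (vf_val (x + y));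
  val_surj : forall a, exists x, vf_val x = a
}.

Section ResidueField.
Variable K : valuedField.
Local Notation v := (@vf_val K).

Definition valuation_ring : {pred K} := [pred x | ele (Some 0) (v x)].

Lemma ele_Some (V : orderedGroupType) (x y : V) :
  ele (Some x) (Some y) = (x <= y).
Proof. by rewrite le_eqVlt. Qed.

Lemma og_addr_ge0 (V : orderedGroupType) (x y : V) :
  0 <= x -> 0 <= y -> 0 <= x + y.
Proof.
move=> x0 y0; apply: (le_trans y0).
by have := og_translate y _ _ x0; rewrite add0r.
Qed.

Lemma og_addr_gt0 (V : orderedGroupType) (x y : V) :
  0 <= x -> 0 < y -> 0 < x + y.
Proof.
move=> x0 y0; apply: (lt_le_trans y0).
by have := og_translate y _ _ x0; rewrite add0r.
Qed.

Lemma val0 : v 0 = None.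
Proof. exact/val_eq_infty. Qed.

Lemma val1 : v 1 = Some 0.
Proof.
have := valM (1 : K) 1; rewrite mulr1; case E: (v 1) => [g|] /=.
  by case=> /(congr1 (fun h => h - g)); rewrite subrr addrK => <-.
by move/val_eq_infty: E => /eqP; rewrite oner_eq0.
Qed.

Lemma valN1 : v (- 1) = Some 0.
Proof.
have := valM (- 1 : K) (- 1); rewrite mulrNN mulr1 val1.
case: (v (- 1)) => [g|] //= [] gg; congr Some.
case/orP: (og_total g 0) => g0; apply: le_anti; rewrite g0 ?andbT /=.
  by have := og_translate g _ _ g0; rewrite add0r -gg.
by have := og_translate g _ _ g0; rewrite add0r -gg.
Qed.

Lemma valN x : v (- x) = v x.
Proof.
by rewrite -mulN1r valM valN1; case: (v x) => //= g; rewrite add0r.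
Qed.

Lemma valuation_ring_closed : subring_closed valuation_ring.
Proof.
split=> [|x y|x y]; rewrite !inE.
- by rewrite val1 ele_Some.
- move=> x0 y0; have := valD x (- y); rewrite valN /emin.
  move: x0 y0; case: (v x) => [a|]; case: (v y) => [b|];
    case: (v (x - y)) => [c|] //=; rewrite ?ele_Some //.
  + by case: ifP => _ a0 b0; rewrite ele_Some; apply: le_trans.
  + by move=> a0 _; apply: le_trans.
  + by move=> _; apply: le_trans.
- rewrite valM; case: (v x) => [a|]; case: (v y) => [b|] //=.
  by rewrite !ele_Some; apply: og_addr_ge0.
Qed.

HB.instance Definition _ :=
  GRing.isSubringClosed.Build K valuation_ring valuation_ring_closed.

Record valuation_ring_type := ValuationRing {
  valuation_ring_val :> K;
  _ : valuation_ring_val \in valuation_ring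
}.
HB.instance Definition _ := [isSub for valuation_ring_val].
HB.instance Definition _ := [Choice of valuation_ring_type by <:].
HB.instance Definition _ :=
  [SubChoice_isSubComNzRing of valuation_ring_type by <:].

Definition maximal_ideal : {pred valuation_ring_type} :=
  [pred x | elt (Some 0) (v (valuation_ring_val x))].

Lemma maximal_ideal_closed : idealr_closed maximal_ideal.
Proof.
split; rewrite ?inE /=.
- by rewrite val0.
- by rewrite val1 /= ltxx.
- move=> [a a0] x y; rewrite !inE /=.
  set u := valuation_ring_val x; set w := valuation_ring_val y => x0 y0.
  have ax0 : elt (Some 0) (v (a * u)).
    rewrite valM; move: a0 x0; rewrite inE.
    case: (v a) => [c|]; case: (v u) => [d|] //=.
    by rewrite ele_Some; apply: og_addr_gt0.
  have := valD (a * u) w; move: ax0 y0; rewrite /emin.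
  case: (v (a * u)) => [c|]; case: (v w) => [d|];
    case: (v (a * u + w)) => [e|] //=.
  + by case: ifP => _ c0 d0; rewrite ele_Some; apply: lt_le_trans.
  + by rewrite ele_Some => c0 _; apply: lt_le_trans.
  + by rewrite ele_Some => _; apply: lt_le_trans.
Qed.

HB.instance Definition _ :=
  isIdealr.Build valuation_ring_type maximal_ideal maximal_ideal_closed.

Definition residue_field : comNzRingType := {ideal_quot maximal_ideal}.

End ResidueField.

Definition has_characteristic (R : nzRingType) (n : nat) : Prop :=
  if n is 0%N then [pchar R] =i pred0 else n \in [pchar R].

Definition possible_characteristics (p q : nat) : Prop :=
  (prime p /\ q = p) \/ (p = 0%N /\ (q = 0%N \/ prime q)).

(* Models of ACVF(L).  Division by n is uniquely determined by [acvf_divP],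
   ordered groups being torsion-free, and total on V since V is divisible. *)
Record acvf (p q : nat) := Acvf {
  acvf_vf :> valuedField;
  acvf_closed : GRing.closed_field_axiom acvf_vf;
  acvf_nontrivial : exists g : vf_group acvf_vf, g != 0;
  acvf_char : has_characteristic acvf_vf p;
  acvf_residue_char : has_characteristic (residue_field acvf_vf) q;
  acvf_div : nat -> vf_group acvf_vf -> vf_group acvf_vf;
  acvf_divP : forall n g, (0 < n)%N -> acvf_div n g *+ n = g
}.

(* Variables of either sort are numbered by [nat]. *)
Inductive fterm : Type :=
| FVar of nat
| FZero
| FOne
| FAdd of fterm & fterm
| FSub of fterm & fterm
| FMul of fterm & fterm.

(* [GDiv n t] stands for t / (n + 1), so that only the divisions by the
   integers at least 1 are function symbols. *)
Inductive gterm : Type :=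
| GVar of nat
| GZero
| GInfty
| GAdd of gterm & gterm
| GSub of gterm & gterm
| GDiv of nat & gterm
| GVal of fterm.

Inductive formula : Type :=
| FEq of fterm & fterm
| GEq of gterm & gterm
| GLt of gterm & gterm
| Bot
| Not of formula
| And of formula & formula
| Or of formula & formula
| Imp of formula & formula
| FEx of nat & formula
| FAll of nat & formula
| GEx of nat & formula
| GAll of nat & formula.

Fixpoint quantifier_free (phi : formula) : bool :=
  match phi with
  | FEq _ _ | GEq _ _ | GLt _ _ | Bot => true
  | Not f => quantifier_free f
  | And f g | Or f g | Imp f g => quantifier_free f && quantifier_free g
  | FEx _ _ | FAll _ _ | GEx _ _ | GAll _ _ => false
  end.

Definition update (T : Type) (e : nat -> T) (i : nat) (x : T) : nat -> T :=
  fun j => if j == i then x else e j.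

Section Semantics.
Variables (p q : nat) (M : acvf p q).
Local Notation K := (vf_field M).
Local Notation G := (option (vf_group M)).

Fixpoint feval (e : nat -> K) (t : fterm) : K :=
  match t with
  | FVar i => e i
  | FZero => 0
  | FOne => 1
  | FAdd s t => feval e s + feval e t
  | FSub s t => feval e s - feval e t
  | FMul s t => feval e s * feval e t
  end.

Fixpoint geval (e : nat -> K) (h : nat -> G) (t : gterm) : G :=
  match t with
  | GVar i => h i
  | GZero => Some 0
  | GInfty => None
  | GAdd s t => eadd (geval e h s) (geval e h t)
  | GSub s t => esub (geval e h s) (geval e h t)
  | GDiv n t => omap (acvf_div n.+1) (geval e h t)
  | GVal t => vf_val (feval e t)
  end.

Fixpoint holds (e : nat -> K) (h : nat -> G) (phi : formula) : Prop :=
  match phi with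
  | FEq s t => feval e s = feval e t
  | GEq s t => geval e h s = geval e h t
  | GLt s t => elt (geval e h s) (geval e h t)
  | Bot => False
  | Not f => ~ holds e h f
  | And f g => holds e h f /\ holds e h g
  | Or f g => holds e h f \/ holds e h g
  | Imp f g => holds e h f -> holds e h g
  | FEx i f => exists x : K, holds (update e i x) h f
  | FAll i f => forall x : K, holds (update e i x) h f
  | GEx i f => exists a : G, holds e (update h i a) f
  | GAll i f => forall a : G, holds e (update h i a) f
  end.

End Semantics.

Definition acvf_equivalent (p q : nat) (phi psi : formula) : Prop :=
  forall (M : acvf p q) (e : nat -> M) (h : nat -> option (vf_group M)),
    holds e h phi <-> holds e h psi.

(* Main.v *)
(* Quantifiers over the value group are removed by linear elimination in a
   divisible ordered group with a last element.

   For a quantifier over the field, the valuations of the polynomials in the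
   quantified variable [x] are first named by variables of the value group
   sort, so that only [exists x, forall j, v (P_j x) = h_j] remains.
   Let [a] be the root of the [P_j] closest to [x], and [d = v (x - a)]: then
   [v (P_j x)] is the minimum of [v (P_j^(m) a / m!) + m d] over [m], and
   conversely these minima are the valuations at a generic point of the ball of
   center [a] and radius [d].  It remains to eliminate a root [a] of some [Q]
   from [forall i, v (R_i a) = h_i].  If [a_1, .., a_d] are the roots of [Q], the
   coefficients of the form [prod_k (U_0 + sum_i R_i(a_k) U_i)] are, up to powers
   of the leading coefficient of [Q], polynomials in the coefficients of [Q] and
   of the [R_i].  By Gauss's lemma their valuations compute the function
   [u |-> sum_k min(u_0, min_i (u_i + v (R_i a_k)))], which determines the
   multiset of vectors [(v (R_i a_k))_i].  This is expressed by quantifying over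
   the value group only. *)
From HB Require Import structures.
From mathcomp Require Import all_boot all_order all_algebra.
From Stdlib Require Import Classical FunctionalExtensionality.
Require Import Defs.
Set Implicit Arguments.
Unset Strict Implicit.
Unset Printing Implicit Defensive.
Import Order.TTheory GRing.Theory.
Local Open Scope ring_scope.

(** * Ordered groups with infinity *)

(** The obstacle is that a single root of [Q] is not given by a term in the parameters: only
    symmetric functions of all the roots are. Hence the vectors [(v (R_i a_k))_i] are handled
    together, as a table that value-group quantifiers guess and that the coefficients of one product
    certify. This product is computed as a determinant: [det F(A)] is the product of the values of
    [F] at the eigenvalues of a companion matrix [A]. The variables U_i become powers of one
    variable, spaced widely enough for an exponent to recall its monomial. U_0 is attached to the
    constant form 1; it truncates each minimum at a finite level, so that the sums stay in the group
    and cancel even when some [v (R_i a_k)] is infinite.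

    Generic points come from roots of equations [x * prod (x - b) = 1], where no factor can be small
    without another being large.

    One formula has to serve in all models. The notions [qfd], [pw], [gdef] and [pdef] therefore
    speak of all models at once, and it is their closure properties that produce the formula. *)

Section OrderedGroups.
Variable V : orderedGroupType.
Implicit Types x y z : V.

Lemma og_leD2r z x y : (x + z <= y + z :> V) = (x <= y).
Proof.
apply/idP/idP; last exact: og_translate.
by move/(og_translate (- z)); rewrite !addrK.
Qed.

Lemma og_ltD2r z x y : (x + z < y + z :> V) = (x < y).
Proof. by rewrite !lt_def og_leD2r (inj_eq (addIr z)). Qed.

Lemma og_leNgt x y : (x <= y) = ~~ (y < x).
Proof. by case: (comparable_leP (og_total x y)). Qed.

Lemma og_ltNge x y : (x < y) = ~~ (y <= x).
Proof. by rewrite og_leNgt negbK. Qed.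

Lemma og_subr_gt0 x y : (0 < y - x :> V) = (x < y).
Proof. by rewrite -(og_ltD2r (- x) x y) subrr. Qed.

Lemma og_subr_ge0 x y : (0 <= y - x :> V) = (x <= y).
Proof. by rewrite -(og_leD2r (- x) x y) subrr. Qed.

Lemma og_ltrN2 x y : (- x < - y :> V) = (y < x).
Proof. by rewrite -og_subr_gt0 opprK addrC og_subr_gt0. Qed.

Lemma og_lerN2 x y : (- x <= - y :> V) = (y <= x).
Proof. by rewrite -og_subr_ge0 opprK addrC og_subr_ge0. Qed.

Lemma og_mulrn_ge0 n x : 0 <= x -> (0 <= x *+ n :> V).
Proof.
by move=> x0; elim: n => [|n IH]; rewrite ?mulr0n // mulrS; apply: og_addr_ge0.
Qed.

Lemma og_mulrn_gt0 n x : 0 < x -> (0 < x *+ n.+1 :> V).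
Proof.
by move=> x0; rewrite mulrSr; apply: og_addr_gt0; rewrite ?og_mulrn_ge0 ?ltW.
Qed.

Lemma og_ltr_Mn n x y : (x *+ n.+1 < y *+ n.+1 :> V) = (x < y).
Proof.
apply/idP/idP; last first.
  by rewrite -og_subr_gt0 -[_ < _ *+ _]og_subr_gt0 -mulrnBl; apply: og_mulrn_gt0.
rewrite !og_ltNge; apply: contra.
rewrite -og_subr_ge0 -[_ <= _ *+ _]og_subr_ge0 -mulrnBl; exact: og_mulrn_ge0.
Qed.

Lemma og_pos_exists : (exists g : V, g != 0) -> exists g : V, 0 < g.
Proof.
case=> g g0; case: (boolP (0 < g)) => [|gn]; first by exists g.
by exists (- g); rewrite -oppr0 og_ltrN2 lt_def eq_sym g0 og_leNgt.
Qed.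

Lemma og_pos_below (s : seq V) :
    (exists g : V, 0 < g) -> (forall x, x \in s -> 0 < x) ->
  exists2 e : V, 0 < e & forall x, x \in s -> e <= x.
Proof.
move=> [g g0]; elim: s => [|x s IH] sP; first by exists g.
have [y sy|e e0 eP] := IH; first by apply: sP; rewrite inE sy orbT.
have x0 : 0 < x by apply: sP; rewrite inE eqxx.
case: (comparable_leP (og_total e x)) => ex.
  by exists e => // y; rewrite inE => /orP[/eqP->//|/eP].
exists x => // y; rewrite inE => /orP[/eqP->//|/eP]; apply: le_trans.
exact: ltW.
Qed.

Lemma og_above (s : seq V) :
  (exists g : V, 0 < g) -> exists b : V, forall x, x \in s -> x < b.
Proof.
move=> [g g0]; elim: s => [|x s [b bP]]; first by exists 0.
case: (comparable_leP (og_total b x)) => bx; last first.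
  by exists b => y; rewrite inE => /orP[/eqP->//|/bP].
have xg : (x < x + g :> V) by rewrite -{1}[x]add0r [x + g]addrC og_ltD2r.
exists (x + g) => y; rewrite inE => /orP[/eqP->//|/bP yb].
by apply: lt_trans xg; apply: lt_le_trans bx.
Qed.

End OrderedGroups.

Section Extended.
Variable V : orderedGroupType.
Implicit Types a b c : option V.

Lemma ele_refl a : ele a a.
Proof. by rewrite /ele eqxx. Qed.

Lemma ele_None a : ele a None.
Proof. by case: a. Qed.

Lemma ele_trans b a c : ele a b -> ele b c -> ele a c.
Proof.
case: a b c => [x|] [y|] [z|] //; rewrite !ele_Some; exact: le_trans.
Qed.

Lemma ele_anti a b : ele a b -> ele b a -> a = b.
Proof.
case: a b => [x|] [y|] //; rewrite !ele_Some => xy yx.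
by congr Some; apply/eqP; rewrite eq_le xy.
Qed.

Lemma eltNele a b : elt a b = ~~ ele b a.
Proof. by case: a b => [x|] [y|] //; rewrite ele_Some /= og_ltNge. Qed.

Lemma eleNelt a b : ele a b = ~~ elt b a.
Proof. by rewrite eltNele negbK. Qed.

Lemma ele_total a b : ele a b || ele b a.
Proof. by case: a b => [x|] [y|] //; rewrite !ele_Some og_total. Qed.

Lemma eltW a b : elt a b -> ele a b.
Proof. by move=> h; rewrite /ele h orbT. Qed.

Lemma ele_lt_trans b a c : ele a b -> elt b c -> elt a c.
Proof.
by move=> ab; rewrite !eltNele; apply: contra => ca; apply: ele_trans ab.
Qed.

Lemma elt_le_trans b a c : elt a b -> ele b c -> elt a c.
Proof.
by move=> + bc; rewrite !eltNele; apply: contra => ca; apply: ele_trans ca.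
Qed.

Lemma elt_neq a b : (a == b) = ~~ elt a b && ~~ elt b a.
Proof.
rewrite !eltNele !negbK; apply/eqP/andP => [->|[]]; first by rewrite ele_refl.
by move=> h1 h2; apply: ele_anti.
Qed.

Lemma elt_trichotomy a b :
  [\/ [/\ elt a b, a <> b & ~ elt b a], [/\ a = b, ~ elt a b & ~ elt b a]
   | [/\ elt b a, a <> b & ~ elt a b]].
Proof.
have := elt_neq a b; case: (eqVneq a b) => [->|/eqP ne].
  by case: (elt b b) => // _; constructor 2.
case: (boolP (elt a b)) => ab; case: (boolP (elt b a)) => ba //= _.
- by move: ba; rewrite eltNele (eltW ab).
- by constructor 1; split=> //; apply/negP.
- by constructor 3; split=> //; apply/negP.
Qed.

Lemma ele_emin c a b : ele c (emin a b) = ele c a && ele c b.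
Proof.
rewrite /emin; case: ifPn => ab.
  by case: (boolP (ele c a)) => // ca; rewrite (ele_trans ca (eltW ab)).
rewrite andbC; case: (boolP (ele c b)) => //= cb.
by rewrite (ele_trans cb) // eleNelt.
Qed.

Lemma emin_lel a b : ele (emin a b) a.
Proof. by have := ele_refl (emin a b); rewrite ele_emin => /andP[]. Qed.

Lemma emin_ler a b : ele (emin a b) b.
Proof. by have := ele_refl (emin a b); rewrite ele_emin => /andP[]. Qed.

(** An element is determined by its lower bounds. Since [c] is below a minimum exactly when it is
    below every entry, identities between minima become Boolean ones. *)
Lemma ele_eq a b : (forall c, ele c a = ele c b) -> a = b.
Proof.
move=> h; apply: ele_anti; first by rewrite -h ele_refl.
by rewrite h ele_refl.
Qed.

Lemma eminA : associative (@emin V).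
Proof. by move=> a b c; apply: ele_eq => d; rewrite !ele_emin andbA. Qed.

Lemma eminC : commutative (@emin V).
Proof. by move=> a b; apply: ele_eq => d; rewrite !ele_emin andbC. Qed.

Lemma emin_None : left_id None (@emin V).
Proof. by move=> a; apply: ele_eq => d; rewrite !ele_emin ele_None. Qed.

Lemma eaddA : associative (@eadd V).
Proof. by move=> [x|] [y|] [z|] //=; rewrite addrA. Qed.

Lemma eaddC : commutative (@eadd V).
Proof. by move=> [x|] [y|] //=; rewrite addrC. Qed.

Lemma eadd0 : left_id (Some 0) (@eadd V).
Proof. by move=> [x|] //=; rewrite add0r. Qed.

Lemma eaddNone a : eadd a None = None.
Proof. by case: a. Qed.

Lemma ele_add2l c a b : ele a b -> ele (eadd c a) (eadd c b).
Proof.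
case: a b c => [x|] [y|] [z|] //=; rewrite !ele_Some // => xy.
by rewrite ![z + _]addrC og_leD2r.
Qed.

Lemma elt_add2l z a b : elt (eadd (Some z) a) (eadd (Some z) b) = elt a b.
Proof. by case: a b => [x|] [y|] //=; rewrite ![z + _]addrC og_ltD2r. Qed.

Lemma eadd_SomeI z : injective (@eadd V (Some z)).
Proof.
by move=> [x|] [y|] //= [] /addrI->.
Qed.

End Extended.

HB.instance Definition _ (V : orderedGroupType) :=
  Monoid.isComLaw.Build (option V) None (@emin V)
    (@eminA V) (@eminC V) (@emin_None V).

HB.instance Definition _ (V : orderedGroupType) :=
  Monoid.isComLaw.Build (option V) (Some 0) (@eadd V)
    (@eaddA V) (@eaddC V) (@eadd0 V).

Definition nmul (V : orderedGroupType) n (a : option V) : option V :=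
  iter n (eadd a) (Some 0).

Section BigMin.
Variable V : orderedGroupType.

Lemma ele_bigmin (I : eqType) (r : seq I) (F : I -> option V) c :
  ele c (\big[@emin V/None]_(i <- r) F i) = all (fun i => ele c (F i)) r.
Proof.
elim: r => [|i r IH]; first by rewrite big_nil ele_None.
by rewrite big_cons ele_emin IH.
Qed.

Lemma ele_bigminP n (F : nat -> option V) c :
  reflect (forall i, (i < n)%N -> ele c (F i))
          (ele c (\big[@emin V/None]_(i < n) F i)).
Proof.
rewrite -(big_mkord predT F) ele_bigmin.
apply: (iffP allP) => h i; last by rewrite mem_index_iota => /h.
by move=> ltin; apply: h; rewrite mem_index_iota.
Qed.

Lemma bigmin_attained n (F : nat -> option V) :
  \big[@emin V/None]_(i < n) F i = None \/
  exists2 i, (i < n)%N & \big[@emin V/None]_(i < n) F i = F i.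
Proof.
elim: n => [|n IH]; first by left; rewrite big_ord0.
rewrite big_ord_recr /= /emin; case: ifP => _; last by right; exists n.
by case: IH => [|[i lt_in e]]; [left | right; exists i => //; apply: leqW].
Qed.

Lemma nmulE n (x : V) : nmul n (Some x) = Some (x *+ n).
Proof. by elim: n => //= n ->; rewrite /= mulrS. Qed.

Lemma bigeadd_Some (I : Type) (r : seq I) (F : I -> V) :
  \big[@eadd V/Some 0]_(i <- r) Some (F i) = Some (\sum_(i <- r) F i).
Proof.
by elim: r => [|i r IH]; rewrite ?big_nil // !big_cons IH.
Qed.

End BigMin.

(** * Quantifier-free definability *)

Section Definability.
Variables p q : nat.

(** Given in every model simultaneously, so that a defining formula cannot depend on the model. *)
Definition relation :=
  forall M : acvf p q, (nat -> M) -> (nat -> option (vf_group M)) -> Prop.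

Implicit Types (D P Q : relation).

(** [D] collects the hypotheses of the current branch of a case distinction; outside [D] the formula
    is unconstrained. *)
Definition qfd D P := exists psi, quantifier_free psi /\
  forall M e h, D M e h -> (holds e h psi <-> P M e h).

Definition qfdef P := qfd (fun _ _ _ => True) P.

Lemma qfd_ext D P Q :
  (forall M e h, D M e h -> (P M e h <-> Q M e h)) -> qfd D P -> qfd D Q.
Proof.
move=> PQ [psi [qf psiP]]; exists psi; split=> // M e h De.
by rewrite psiP // PQ.
Qed.

Lemma qfdef_ext P Q :
  (forall M e h, P M e h <-> Q M e h) -> qfdef P -> qfdef Q.
Proof. by move=> PQ; apply: qfd_ext. Qed.

Lemma qfd_sub D D' P :
  (forall M e h, D' M e h -> D M e h) -> qfd D P -> qfd D' P.
Proof.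
by move=> sub [psi [qf psiP]]; exists psi; split=> // M e h /sub; apply: psiP.
Qed.

Lemma qfd_def D P : qfdef P -> qfd D P.
Proof. exact: qfd_sub. Qed.

Lemma qfd_formula D phi : quantifier_free phi ->
  qfd D (fun M e h => holds e h phi).
Proof. by exists phi. Qed.

Lemma qfd_False D : qfd D (fun _ _ _ => False).
Proof. by exists Bot. Qed.

Lemma qfd_not D P : qfd D P -> qfd D (fun M e h => ~ P M e h).
Proof.
move=> [psi [qf psiP]]; exists (Not psi); split=> // M e h De /=.
by rewrite psiP.
Qed.

Lemma qfd_and D P Q : qfd D P -> qfd D Q ->
  qfd D (fun M e h => P M e h /\ Q M e h).
Proof.
move=> [f [qf fP]] [g [qg gP]]; exists (And f g); split; first by rewrite /= qf.
by move=> M e h De /=; rewrite fP // gP.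
Qed.

Lemma qfd_or D P Q : qfd D P -> qfd D Q ->
  qfd D (fun M e h => P M e h \/ Q M e h).
Proof.
move=> [f [qf fP]] [g [qg gP]]; exists (Or f g); split; first by rewrite /= qf.
by move=> M e h De /=; rewrite fP // gP.
Qed.

Lemma qfd_const D (b : Prop) : qfd D (fun _ _ _ => b).
Proof.
have [bT|bF] := classic b; last by apply: qfd_ext (qfd_False D).
by apply: qfd_ext (qfd_not (qfd_False D)) => M e h _; split=> // _ [].
Qed.

Lemma qfd_ex_lt D n (F : nat -> relation) :
  (forall i, (i < n)%N -> qfd D (F i)) ->
  qfd D (fun M e h => exists2 i, (i < n)%N & F i M e h).
Proof.
elim: n => [|n IH] FP.
  by apply: qfd_ext (qfd_False D) => M e h _; split=> // - [].
apply: qfd_ext (qfd_or (IH _) (FP n (ltnSn n))) => [M e h _|i lt_in]; last first.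
  exact/FP/leqW.
split=> [[[i lt_in]|]|[i]]; first by exists i => //; apply: leqW.
  by exists n.
by rewrite ltnS leq_eqVlt => /orP[/eqP->|]; [right | left; exists i].
Qed.

Lemma qfd_all_lt D n (F : nat -> relation) :
  (forall i, (i < n)%N -> qfd D (F i)) ->
  qfd D (fun M e h => forall i, (i < n)%N -> F i M e h).
Proof.
elim: n => [|n IH] FP.
  by apply: qfd_ext (qfd_const D True) => M e h _; split.
apply: qfd_ext (qfd_and (IH _) (FP n (ltnSn n))) => [M e h _|i lt_in]; last first.
  exact/FP/leqW.
split=> [[FL Fn] i|FS].
  by rewrite ltnS leq_eqVlt => /orP[/eqP->//|]; apply: FL.
by split=> [i lt_in|]; apply: FS => //; apply: leqW.
Qed.

Lemma qfd_cases D G P : qfdef G ->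
  qfd (fun M e h => D M e h /\ G M e h) P ->
  qfd (fun M e h => D M e h /\ ~ G M e h) P -> qfd D P.
Proof.
move=> [g [qg gP]] [f1 [q1 f1P]] [f2 [q2 f2P]].
exists (Or (And g f1) (And (Not g) f2)); split; first by rewrite /= qg q1 q2.
move=> M e h De /=; rewrite gP //.
have [Ge|Ge] := classic (G M e h).
  by rewrite f1P //; tauto.
by rewrite f2P //; tauto.
Qed.

(* [pw R]: finitely many values [t], chosen by a quantifier-free case
   distinction on the environment, satisfy [R t].  The impredicative form
   says that it suffices to define any given predicate case by case. *)
Record pw T (R : forall M : acvf p q,
    (nat -> M) -> (nat -> option (vf_group M)) -> T -> Prop) : Prop := Pw {
  pw_elim : forall D P,
    (forall t, qfd (fun M e h => D M e h /\ R M e h t) P) -> qfd D P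
}.

Lemma pw_leaf T R (t : T) : (forall M e h, R M e h t) -> pw R.
Proof. by move=> Rt; split=> D P /(_ t); apply: qfd_sub. Qed.

(** Composition of case distinctions: the second may depend on the value [t] chosen by the first,
    and has to be correct only where [t] is. *)
Lemma pw_bind T U (R : forall M e h, T -> Prop) (S : forall M e h, U -> Prop) :
  pw R -> (forall t, pw (fun M e h u => R M e h t -> S M e h u)) -> pw S.
Proof.
move=> pR pS; split=> D P H; apply: (pw_elim pR) => t.
apply: (pw_elim (pS t)) => u; apply: qfd_sub (H u) => M e h; tauto.
Qed.

Lemma pw_weaken T (R R' : forall M e h, T -> Prop) :
  (forall M e h t, R M e h t -> R' M e h t) -> pw R -> pw R'.
Proof.
move=> RR' pR; apply: pw_bind pR _ => t; apply: (pw_leaf (t := t)) => M e h.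
exact: RR'.
Qed.

Lemma pw_cases T (R : forall M e h, T -> Prop) G : qfdef G ->
  pw (fun M e h t => G M e h -> R M e h t) ->
  pw (fun M e h t => ~ G M e h -> R M e h t) -> pw R.
Proof.
move=> gP p1 p2; split=> D P H.
apply: (qfd_cases gP); [apply: (pw_elim p1) | apply: (pw_elim p2)] => t.
  by apply: qfd_sub (H t) => M e h; tauto.
by apply: qfd_sub (H t) => M e h; tauto.
Qed.

Lemma qfdef_pw T (R : forall M e h, T -> Prop) P : pw R ->
  (forall t, qfd (fun M e h => R M e h t) P) -> qfdef P.
Proof.
by move=> pR H; apply: (pw_elim pR) => t; apply: qfd_sub (H t) => M e h [].
Qed.

Fixpoint gsubst (s : nat -> gterm) t : gterm :=
  match t with
  | GVar i => s i
  | GAdd t u => GAdd (gsubst s t) (gsubst s u)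
  | GSub t u => GSub (gsubst s t) (gsubst s u)
  | GDiv n t => GDiv n (gsubst s t)
  | _ => t
  end.

Fixpoint qfsubst (s : nat -> gterm) f : formula :=
  match f with
  | GEq t u => GEq (gsubst s t) (gsubst s u)
  | GLt t u => GLt (gsubst s t) (gsubst s u)
  | Not f => Not (qfsubst s f)
  | And f g => And (qfsubst s f) (qfsubst s g)
  | Or f g => Or (qfsubst s f) (qfsubst s g)
  | Imp f g => Imp (qfsubst s f) (qfsubst s g)
  | _ => f
  end.

Lemma geval_subst (M : acvf p q) (e : nat -> M) h s t :
  geval e h (gsubst s t) = geval e (fun i => geval e h (s i)) t.
Proof. by elim: t => //= [t -> u ->|t -> u ->|n t ->]. Qed.

Lemma qfsubst_qf s f : quantifier_free f -> quantifier_free (qfsubst s f).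
Proof. by elim: f => //= f IHf g IHg /andP[/IHf-> /IHg->]. Qed.

Lemma holds_subst (M : acvf p q) (e : nat -> M) h s f : quantifier_free f ->
  holds e h (qfsubst s f) <-> holds e (fun i => geval e h (s i)) f.
Proof.
elim: f => //=; try by move=> *; rewrite !geval_subst.
- by move=> f IH /IH->.
- by move=> f IHf g IHg /andP[/IHf-> /IHg->].
- by move=> f IHf g IHg /andP[/IHf-> /IHg->].
- by move=> f IHf g IHg /andP[/IHf-> /IHg->].
Qed.

Lemma qfdef_subst (s : nat -> gterm) P : qfdef P ->
  qfdef (fun M e h => P M e (fun i => geval e h (s i))).
Proof.
move=> [psi [qf psiP]]; exists (qfsubst s psi); split; first exact: qfsubst_qf.
by move=> M e h _; rewrite holds_subst // psiP.
Qed.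

Definition tdef (f : forall M : acvf p q, (nat -> M) -> M) :=
  exists t, forall M e, feval e t = f M e.

(** Terms are allowed to vary with the case, because the language has no symbol for the minimum of
    two values. *)
Definition gdef (f : forall M : acvf p q,
    (nat -> M) -> (nat -> option (vf_group M)) -> option (vf_group M)) :=
  pw (fun M e h t => geval e h t = f M e h).

Lemma gdef_ext f g : (forall M e h, f M e h = g M e h) -> gdef f -> gdef g.
Proof. by move=> fg; apply: pw_weaken => M e h t ->. Qed.

Lemma gdef_term t : gdef (fun M e h => geval e h t).
Proof. exact: (pw_leaf (t := t)). Qed.

Lemma gdef_var i : gdef (fun M e h => h i).
Proof. exact: (gdef_term (GVar i)). Qed.

Lemma gdef_0 : gdef (fun M e h => Some 0).
Proof. exact: (gdef_term (GZero)). Qed.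

Lemma gdef_val f : tdef f -> gdef (fun M e h => vf_val (f M e)).
Proof.
by case=> t tP; apply: (pw_leaf (t := GVal t)) => M e h /=; rewrite tP.
Qed.

Lemma gdef_add f g : gdef f -> gdef g ->
  gdef (fun M e h => eadd (f M e h) (g M e h)).
Proof.
move=> fP gP; apply: pw_bind fP _ => t; apply: pw_bind gP _ => u.
by apply: (pw_leaf (t := GAdd t u)) => M e h /= -> ->.
Qed.

Lemma qfdef_eq f g : gdef f -> gdef g -> qfdef (fun M e h => f M e h = g M e h).
Proof.
move=> fP gP; apply: (qfdef_pw fP) => t; apply: (pw_elim gP) => u.
by exists (GEq t u); split=> // M e h /= [<- <-].
Qed.

Lemma qfdef_lt f g : gdef f -> gdef g ->
  qfdef (fun M e h => elt (f M e h) (g M e h)).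
Proof.
move=> fP gP; apply: (qfdef_pw fP) => t; apply: (pw_elim gP) => u.
by exists (GLt t u); split=> // M e h /= [<- <-].
Qed.

Lemma gdef_emin f g : gdef f -> gdef g ->
  gdef (fun M e h => emin (f M e h) (g M e h)).
Proof.
move=> fP gP; apply: (pw_cases (qfdef_lt fP gP)).
  by apply: pw_weaken fP => M e h t -> lt_fg; rewrite /emin lt_fg.
by apply: pw_weaken gP => M e h t -> /negP/negPf lt_fg; rewrite /emin lt_fg.
Qed.

Lemma gdef_nmul n f : gdef f -> gdef (fun M e h => nmul n (f M e h)).
Proof. by move=> fP; elim: n => [|n IH]; [exact: gdef_0 | exact: gdef_add]. Qed.

Lemma gdef_None : gdef (fun M e h => None).
Proof. exact: (gdef_term (GInfty)). Qed.

Lemma gdef_bigadd n f : (forall i, (i < n)%N -> gdef (f i)) ->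
  gdef (fun M e h => \big[@eadd _/Some 0]_(i < n) f i M e h).
Proof.
elim: n => [|n IH] fP.
  by apply: gdef_ext gdef_0 => M e h; rewrite big_ord0.
apply: gdef_ext (gdef_add (IH _) (fP n (ltnSn n))) =>
  [M e h|i /leqW]; last exact: fP.
by rewrite big_ord_recr.
Qed.

Lemma gdef_bigmin n f : (forall i, (i < n)%N -> gdef (f i)) ->
  gdef (fun M e h => \big[@emin _/None]_(i < n) f i M e h).
Proof.
elim: n => [|n IH] fP.
  by apply: gdef_ext gdef_None => M e h; rewrite big_ord0.
apply: gdef_ext (gdef_emin (IH _) (fP n (ltnSn n))) =>
  [M e h|i /leqW]; last exact: fP.
by rewrite big_ord_recr.
Qed.

Lemma qfdef_feq0 f : tdef f -> qfdef (fun M e h => f M e = 0).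
Proof.
by case=> t tP; exists (FEq t FZero); split=> // M e h _ /=; rewrite tP.
Qed.

End Definability.

(** * Quantifiers over the value group *)

Section ValueGroupElimination.
Variables p q : nat.
Local Notation relation := (@relation p q).
Local Notation GammaRel :=
  (forall M : acvf p q, (nat -> M) -> (nat -> option (vf_group M)) ->
     vf_group M -> Prop).

Lemma acvf_pos (M : acvf p q) : exists g : vf_group M, 0 < g.
Proof. exact/og_pos_exists/acvf_nontrivial. Qed.

Inductive constr := CLt of gterm | CEq of gterm | CGt of gterm.

Section Semantics.
Variables (M : acvf p q) (e : nat -> M) (h : nat -> option (vf_group M)).

Definition cholds (x : vf_group M) c : Prop :=
  match c with
  | CLt t => elt (Some x) (geval e h t)
  | CEq t => Some x = geval e h t
  | CGt t => elt (geval e h t) (Some x)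
  end.

Fixpoint cholds_all x cs : Prop :=
  if cs is c :: cs then cholds x c /\ cholds_all x cs else True.

(* Disjunctive normal forms, a clause being a formula on the parameters
   together with constraints on the variable. *)
Fixpoint nfholds x (l : seq (formula * seq constr)) : Prop :=
  if l is cl :: l then
    (holds e h cl.1 /\ cholds_all x cl.2) \/ nfholds x l
  else False.

Lemma cholds_all_cat x cs ds :
  cholds_all x (cs ++ ds) <-> cholds_all x cs /\ cholds_all x ds.
Proof. by elim: cs => [|c cs IH] /=; [tauto | rewrite IH; tauto]. Qed.

Lemma nfholds_cat x l m : nfholds x (l ++ m) <-> nfholds x l \/ nfholds x m.
Proof. by elim: l => [|c l IH] /=; [tauto | rewrite IH; tauto]. Qed.

End Semantics.

Definition nf_qf (l : seq (formula * seq constr)) :=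
  all (fun cl => quantifier_free cl.1) l.

Definition nf_and (l m : seq (formula * seq constr)) :=
  [seq (And a.1 b.1, a.2 ++ b.2) | a <- l, b <- m].

Definition constr_not c : seq (formula * seq constr) :=
  match c with
  | CLt t => [:: (Not Bot, [:: CEq t]); (Not Bot, [:: CGt t])]
  | CEq t => [:: (Not Bot, [:: CLt t]); (Not Bot, [:: CGt t])]
  | CGt t => [:: (Not Bot, [:: CLt t]); (Not Bot, [:: CEq t])]
  end.

Definition clause_not cl : seq (formula * seq constr) :=
  (Not cl.1, [::]) :: flatten (map constr_not cl.2).

Definition nf_not l :=
  foldr (fun cl => nf_and (clause_not cl)) [:: (Not Bot, [::])] l.

Lemma nf_and_qf l m : nf_qf l -> nf_qf m -> nf_qf (nf_and l m).
Proof.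
elim: l => //= a l IH /andP[qa ql] qm.
rewrite /nf_and /= /nf_qf all_cat; apply/andP; split; last exact: IH ql qm.
rewrite all_map; elim: m qm {IH} => //= b m IH /andP[qb /IH->].
by rewrite qa qb.
Qed.

Lemma nf_not_qf l : nf_qf l -> nf_qf (nf_not l).
Proof.
elim: l => //= cl l IH /andP[qc /IH ql]; apply: nf_and_qf ql.
rewrite /= qc /=; elim: cl.2 => //= c cs IHc.
by rewrite /nf_qf all_cat; apply/andP; split=> //; case: c.
Qed.

Section NfSemantics.
Variables (M : acvf p q) (e : nat -> M) (h : nat -> option (vf_group M)).
Implicit Type x : vf_group M.

Lemma nfholds_and x l m :
  nfholds e h x (nf_and l m) <-> nfholds e h x l /\ nfholds e h x m.
Proof.
elim: l => [|a l IH] /=; first tauto.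
rewrite /nf_and /= nfholds_cat -/(nf_and l m) IH.
suff -> : nfholds e h x [seq (And a.1 b.1, a.2 ++ b.2) | b <- m] <->
    (holds e h a.1 /\ cholds_all e h x a.2) /\ nfholds e h x m by tauto.
elim: m {IH} => [|b m IH] /=; first tauto.
by rewrite IH cholds_all_cat; tauto.
Qed.

Lemma nfholds_constr_not x c : nfholds e h x (constr_not c) <-> ~ cholds e h x c.
Proof.
by case: c => t /=; have := elt_trichotomy (Some x) (geval e h t) => -[] [];
  tauto.
Qed.

Lemma nfholds_not x l : nfholds e h x (nf_not l) <-> ~ nfholds e h x l.
Proof.
elim: l => [|[f cs] l IH] /=; first tauto.
rewrite nfholds_and IH /=.
suff -> : nfholds e h x (flatten (map constr_not cs)) <-> ~ cholds_all e h x cs.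
  by have := classic (holds e h f); tauto.
elim: cs {IH} => [|c cs IH] /=; first tauto.
rewrite nfholds_cat IH nfholds_constr_not.
by have := classic (cholds e h x c); tauto.
Qed.

End NfSemantics.

(** The variable runs through the group only, where constraints are linear; the value infinity is
    substituted as a term in [qfdef_gex]. *)
Definition tame (P : GammaRel) :=
  pw (fun M e h l => nf_qf l /\ forall x, P M e h x <-> nfholds e h x l).

Lemma tame_ext (P Q : GammaRel) :
  (forall M e h x, P M e h x <-> Q M e h x) -> tame P -> tame Q.
Proof.
by move=> PQ; apply: pw_weaken => M e h l [ql lP]; split=> // x; rewrite -PQ.
Qed.

Lemma tame_not (P : GammaRel) : tame P -> tame (fun M e h x => ~ P M e h x).
Proof.
move=> tP; apply: pw_bind tP _ => l.
apply: (pw_leaf (t := nf_not l)) => M e h [ql lP].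
split=> [|x]; first exact: nf_not_qf.
by rewrite nfholds_not lP.
Qed.

Lemma tame_and (P Q : GammaRel) : tame P -> tame Q ->
  tame (fun M e h x => P M e h x /\ Q M e h x).
Proof.
move=> tP tQ; apply: pw_bind tP _ => l; apply: pw_bind tQ _ => m.
apply: (pw_leaf (t := nf_and l m)) => M e h [qm mP] [ql lP].
split=> [|x]; first exact: nf_and_qf.
by rewrite nfholds_and lP mP.
Qed.

Lemma tame_or (P Q : GammaRel) : tame P -> tame Q ->
  tame (fun M e h x => P M e h x \/ Q M e h x).
Proof.
move=> tP tQ; apply: tame_ext (tame_not (tame_and (tame_not tP) (tame_not tQ))).
by move=> M e h x; have := classic (P M e h x); tauto.
Qed.

Lemma tame_imp (P Q : GammaRel) : tame P -> tame Q ->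
  tame (fun M e h x => P M e h x -> Q M e h x).
Proof.
move=> tP tQ; apply: tame_ext (tame_or (tame_not tP) tQ).
by move=> M e h x; have := classic (P M e h x); tauto.
Qed.

Lemma tame_nf (P : GammaRel) l : nf_qf l ->
  (forall M e h x, P M e h x <-> nfholds e h x l) -> tame P.
Proof. by move=> ql lP; apply: (pw_leaf (t := l)). Qed.

Lemma tame_qf (P : relation) : qfdef P -> tame (fun M e h _ => P M e h).
Proof.
move=> [psi [qf psiP]]; apply: (@tame_nf _ [:: (psi, [::])]) => [|M e h x].
  by rewrite /= qf.
by rewrite /= psiP //; tauto.
Qed.

Lemma between (M : acvf p q) (y : vf_group M) a :
  elt (Some y) a -> exists2 x, y < x & elt (Some x) a.
Proof.
have [g g0] := acvf_pos M.
case: a => [z|] /= yz; last first.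
  exists (y + g) => //; rewrite -{1}[y]add0r [y + g]addrC.
  by rewrite (og_ltD2r y 0 g).
have := acvf_divP (y + z) (isT : 0 < 2)%N; move: (acvf_div _ _) => x xE.
exists x.
  by rewrite -(og_ltr_Mn 1) xE mulr2n ![y + _]addrC og_ltD2r.
by rewrite -(og_ltr_Mn 1) xE mulr2n og_ltD2r.
Qed.

Lemma below (M : acvf p q) (a : option (vf_group M)) :
  exists x, elt (Some x) a.
Proof.
have [g g0] := acvf_pos M; case: a => [z|]; last by exists 0.
exists (z - g); rewrite /= -(og_ltD2r g) subrK -{1}[z]add0r [z + g]addrC.
by rewrite (og_ltD2r z 0 g).
Qed.

Definition above_opt (M : acvf p q) (e : nat -> M) h (lo : option gterm) x :=
  if lo is Some l then elt (geval e h l) (Some x) else true.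

Lemma qfdef_above_opt (lo : option gterm) t :
  qfdef (fun M : acvf p q => fun e h =>
    is_true (if lo is Some l then elt (geval e h l) (geval e h t) else true)).
Proof.
case: lo => [l|]; first exact: qfdef_lt (gdef_term _ _ l) (gdef_term _ _ t).
exact: qfd_const.
Qed.

(** Settles clauses with an equation [x = t]: there [t] replaces the variable, provided that it is
    finite. *)
Lemma qfdef_cholds_term (cs : seq constr) t :
  qfdef (fun (M : acvf p q) e h => exists2 x,
     geval e h t = Some x & cholds_all e h x cs).
Proof.
have tP := gdef_term _ _ t : @gdef p q _.
have tN : qfdef (fun (M : acvf p q) e h => geval e h t <> None).
  exact: qfd_not (qfdef_eq tP (gdef_None _ _)).
elim: cs => [|c cs IH].
  apply: qfdef_ext tN => M e h /=; case: (geval e h t) => [x|].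
    by split=> // _; exists x.
  by split=> // - [].
have cP : qfdef (fun (M : acvf p q) e h => match c with
   | CLt u => is_true (elt (geval e h t) (geval e h u))
   | CEq u => geval e h t = geval e h u
   | CGt u => is_true (elt (geval e h u) (geval e h t)) end).
  case: c => u.
  - exact: qfdef_lt tP (gdef_term _ _ u).
  - exact: qfdef_eq tP (gdef_term _ _ u).
  - exact: qfdef_lt (gdef_term _ _ u) tP.
apply: qfdef_ext (qfd_and IH cP) => M e h; split.
  move=> [[x xE csx] cx]; exists x => //; split=> //.
  by rewrite xE in cx; case: c cx {cP}.
move=> [x xE [cx csx]]; split; first by exists x.
by rewrite xE; case: c cx {cP}.
Qed.

Local Arguments elt : simpl never.

(** The constraints are absorbed one at a time, a comparison of terms telling whether the new bound
    supersedes the old one. At the end only an interval is left, nonempty by density of the group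
    and absence of a least element. The lower bound is optional since no term lies below the whole
    group, whereas [GInfty] is a vacuous upper bound. *)
Lemma qfdef_ex_interval cs lo hi :
  qfdef (fun (M : acvf p q) e h => exists x : vf_group M,
    [/\ above_opt e h lo x, elt (Some x) (geval e h hi) & cholds_all e h x cs]).
Proof.
elim: cs lo hi => [|[] t cs IH] lo hi.
- apply: qfdef_ext (qfdef_above_opt lo hi) => M e h; case: lo => [l|] /=.
    split=> [lt_l|[x [lt_l lt_h _]]]; last first.
      exact: elt_le_trans lt_l (eltW lt_h).
    case: (geval e h l) lt_l => [y|//] /between[x yx xh].
    by exists x.
  by split=> // _; have [x] := below (geval e h hi); exists x.
- have lt_ht := qfdef_lt (gdef_term p q hi) (gdef_term p q t).
  apply: qfdef_ext (qfd_or (qfd_and lt_ht (IH lo hi))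
    (qfd_and (qfd_not lt_ht) (IH lo t))) => M e h /=.
  split.
    case=> [[ht [x [xl xh xc]]]|[/negP]].
      by exists x; split=> //; split=> //; apply: elt_le_trans xh (eltW ht).
    rewrite -eleNelt => le_th [x [xl xt xc]]; exists x; split=> //.
    exact: elt_le_trans xt le_th.
  move=> [x [xl xh [xt xc]]].
  by have [h1|h1] := classic (elt (geval e h hi) (geval e h t)); [left|right];
    split=> //; exists x.
- have bP : qfdef (fun (M : acvf p q) e h =>
      is_true (if lo is Some l then elt (geval e h l) (geval e h t) else true) /\
      elt (geval e h t) (geval e h hi)).
    apply: qfd_and (qfdef_above_opt lo t) _.
    exact: qfdef_lt (gdef_term _ _ t) (gdef_term _ _ hi).
  apply: qfdef_ext (qfd_and bP (qfdef_cholds_term cs t)) => M e h.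
  split=> [[[lt_l lt_h] [x xE xc]]|[x [xl xh [xt xc]]]].
    by exists x; split=> //; [case: lo lt_l {bP} => //= l|]; rewrite -xE.
  split; last by exists x.
  by rewrite -[geval e h t]xt; split=> //; case: lo xl {bP}.
- case: lo => [l|]; last first.
    apply: qfdef_ext (IH (Some t) hi) => M e h; split.
      by move=> [x [xl xh xc]]; exists x.
    by move=> [x [xl xh [xt xc]]]; exists x.
  have lt_lt := qfdef_lt (gdef_term p q l) (gdef_term p q t).
  apply: qfdef_ext (qfd_or (qfd_and lt_lt (IH (Some t) hi))
    (qfd_and (qfd_not lt_lt) (IH (Some l) hi))) => M e h /=.
  split.
    case=> [[lt [x [xl xh xc]]]|[/negP]].
      by exists x; split=> //; apply: elt_le_trans lt (eltW xl).
    rewrite -eleNelt => le_tl [x [xl xh xc]]; exists x; split=> //; split=> //.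
    exact: ele_lt_trans le_tl xl.
  move=> [x [xl xh [xt xc]]].
  by have [h1|h1] := classic (elt (geval e h l) (geval e h t)); [left|right];
    split=> //; exists x.
Qed.

Lemma qfdef_ex_tame (P : GammaRel) : tame P ->
  qfdef (fun M e h => exists x, P M e h x).
Proof.
move=> tP; apply: (qfdef_pw tP) => l.
have [ql|nql] := boolP (nf_qf l); last first.
  by apply: qfd_ext (qfd_False _) => M e h [ql]; case/negP: nql.
apply: (@qfd_ext _ _ _ (fun M e h => exists x, nfholds e h x l)).
  by move=> M e h [_ lP]; split=> -[x xP]; exists x; apply/lP.
apply: qfd_def; elim: l ql => [_|[f cs] l IH /= /andP[qf /IH lP]].
  by apply: qfdef_ext (qfd_False _) => M e h; split=> // -[].
apply: qfdef_ext (qfd_or (qfd_and (qfd_formula _ qf)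
  (qfdef_ex_interval cs None GInfty)) lP) => M e h.
split=> [[[fP [x [_ _ xc]]]|[x xl]]|[x [[fP xc]|xl]]].
- by exists x; left.
- by exists x; right.
- by left; split=> //; exists x.
- by right; exists x.
Qed.

End ValueGroupElimination.

(** * Linear normal form of value-group terms in one variable *)

Section LinearTerms.
Variables p q : nat.
Local Arguments elt : simpl never.

(* Denominators are stored as predecessors, so that they cannot vanish. *)
Definition den n m := (n.+1 * m.+1).-1.
Local Arguments den : simpl never.

Lemma denE n m : (den n m).+1 = (n.+1 * m.+1)%N.
Proof. by rewrite prednK ?muln_gt0. Qed.

Definition gmul n t := iter n (GAdd t) GZero.

Lemma geval_GAdd (M : acvf p q) (e : nat -> M) h s t :
  geval e h (GAdd s t) = eadd (geval e h s) (geval e h t).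
Proof. by []. Qed.

Lemma geval_GSub (M : acvf p q) (e : nat -> M) h s t :
  geval e h (GSub s t) = esub (geval e h s) (geval e h t).
Proof. by []. Qed.

Lemma geval_gmul (M : acvf p q) (e : nat -> M) h n t :
  geval e h (gmul n t) = nmul n (geval e h t).
Proof. by elim: n => //= n <-. Qed.

(* [Some (k, n, c)] stands for the linear function [x |-> (c + k x) / (n + 1)]
   and [None] for the constant function infinity. *)
Definition lin_spec (M : acvf p q) (e : nat -> M) h
    (l : option (int * nat * gterm)) (x : vf_group M) (a : option (vf_group M)) :=
  match l with
  | None => a = None
  | Some (k, n, c) => exists c0 z,
      [/\ geval e h c = Some c0, a = Some z & z *+ n.+1 = c0 + x *~ k]
  end.

Lemma lin_mulrn (V : zmodType) (c x : V) k n :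
  (c + x *~ k) *+ n = c *+ n + x *~ (k * n%:Z).
Proof. by rewrite mulrnDl mulrzA pmulrn. Qed.

Lemma lin_scale (V : zmodType) (z c x : V) k n m :
  z *+ n = c + x *~ k -> z *+ (n * m) = c *+ m + x *~ (k * m%:Z).
Proof. by rewrite mulrnA => ->; rewrite lin_mulrn. Qed.

(** The cases depend only on which subterms free of the variable are infinite, so in each case one
    linear form is valid for all [x] in the group. *)
Lemma gterm_linear i t :
  pw (fun (M : acvf p q) e h l =>
    forall x, lin_spec e h l x (geval e (update h i (Some x)) t)).
Proof.
elim: t => [j|||s IHs t IHt|s IHs t IHt|n t IHt|t].
- have [->|ji] := eqVneq j i.
    apply: (pw_leaf (t := Some (1, 0%N, GZero))) => M e h x /=.
    by rewrite /update eqxx; exists 0, x; rewrite mulr1n add0r.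
  apply: (pw_cases (qfdef_eq (gdef_var _ _ j) (gdef_None _ _))).
    by apply: (pw_leaf (t := None)) => M e h hj x; rewrite /= /update (negPf ji).
  apply: (pw_leaf (t := Some (0, 0%N, GVar j))) => M e h hj x.
  rewrite /= /update (negPf ji); case: (h j) hj => // z _; exists z, z.
  by rewrite mulr1n mulr0z addr0.
- apply: (pw_leaf (t := Some (0, 0%N, GZero))) => M e h x /=.
  by exists 0, 0; rewrite mulr1n mulr0z addr0.
- by apply: (pw_leaf (t := None)).
- apply: pw_bind IHs _ => -[[[k1 n1] c1]|]; last first.
    by apply: (pw_leaf (t := None)) => M e h ls x /=; rewrite ls.
  apply: pw_bind IHt _ => -[[[k2 n2] c2]|]; last first.
    by apply: (pw_leaf (t := None)) => M e h lt ls x /=; rewrite lt eaddNone.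
  apply: (pw_leaf (t := Some (k1 * n2.+1%:Z + k2 * n1.+1%:Z,
    (den n1 n2), GAdd (gmul n2.+1 c1) (gmul n1.+1 c2)))) => M e h lt ls x.
  have [d1 [z1 [c1E sE z1E]]] := ls x; have [d2 [z2 [c2E tE z2E]]] := lt x.
  exists (d1 *+ n2.+1 + d2 *+ n1.+1), (z1 + z2).
  split; first by rewrite geval_GAdd !geval_gmul c1E c2E !nmulE.
    by rewrite geval_GAdd sE tE.
  rewrite denE mulrnDl (lin_scale _ z1E) [(n1.+1 * _)%N]mulnC.
  by rewrite (lin_scale _ z2E) mulrzDr addrACA.
(* The subtrahend is examined first: an infinite one makes the difference 0, whatever the other term
   is. *)
- apply: pw_bind IHt _ => -[[[k2 n2] c2]|]; last first.
    apply: (pw_leaf (t := Some (0, 0%N, GZero))) => M e h lt x /=; rewrite lt.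
    by exists 0, 0; case: (geval _ _ s) => [y|]; rewrite mulr1n mulr0z addr0.
  apply: pw_bind IHs _ => -[[[k1 n1] c1]|]; last first.
    apply: (pw_leaf (t := None)) => M e h ls lt x /=; rewrite ls.
    by have [d2 [z2 [c2E -> z2E]]] := lt x.
  apply: (pw_leaf (t := Some (k1 * n2.+1%:Z - k2 * n1.+1%:Z,
    (den n1 n2), GSub (gmul n2.+1 c1) (gmul n1.+1 c2)))) => M e h ls lt x.
  have [d1 [z1 [c1E sE z1E]]] := ls x; have [d2 [z2 [c2E tE z2E]]] := lt x.
  exists (d1 *+ n2.+1 - d2 *+ n1.+1), (z1 - z2).
  split; first by rewrite geval_GSub !geval_gmul c1E c2E !nmulE.
    by rewrite geval_GSub sE tE.
  rewrite denE mulrnBl (lin_scale _ z1E) [(n1.+1 * _)%N]mulnC.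
  by rewrite (lin_scale _ z2E) mulrzBr opprD addrACA.
- apply: pw_bind IHt _ => -[[[k m] c]|]; last first.
    by apply: (pw_leaf (t := None)) => M e h lt x /=; rewrite lt.
  apply: (pw_leaf (t := Some (k, (den n m), c))) => M e h lt x.
  have [d [z [cE tE zE]]] := lt x.
  exists d, (acvf_div n.+1 z); split=> //; first by rewrite [LHS]/= tE.
  by rewrite denE mulrnA acvf_divP.
- have tP : @gdef p q (fun M e h => vf_val (feval e t)).
    by apply: gdef_val; exists t.
  apply: (pw_cases (qfdef_eq tP (gdef_None _ _))).
    by apply: (pw_leaf (t := None)).
  apply: (pw_leaf (t := Some (0, 0%N, GVal t))) => M e h tN x /=.
  case: (vf_val _) tN => // z _; exists z, z.
  by rewrite mulr1n mulr0z addr0.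
Qed.

Lemma tame_lt i s t :
  @tame p q (fun M e h x => elt (geval e (update h i (Some x)) s)
                                (geval e (update h i (Some x)) t)).
Proof.
apply: pw_bind (gterm_linear i s) _ => -[[[k1 n1] c1]|]; last first.
  apply: (pw_leaf (t := [::])) => M e h ls; split=> // x; rewrite /= ls.
  by split.
apply: pw_bind (gterm_linear i t) _ => -[[[k2 n2] c2]|]; last first.
  apply: (pw_leaf (t := [:: (Not Bot, [::])])) => M e h lt ls; split=> // x.
  by rewrite /= lt; have [d [z [_ -> _]]] := ls x; split=> // _; left; split=> // -[].
(* Clearing denominators and gathering the slopes on the left turns [s < t] into an integer multiple
   of [x] being less than [d]. *)
pose d := GSub (gmul n1.+1 c2) (gmul n2.+1 c1).
have key (M : acvf p q) (e : nat -> M) h :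
    (forall x, lin_spec e h (Some (k2, n2, c2)) x
       (geval e (update h i (Some x)) t)) ->
    (forall x, lin_spec e h (Some (k1, n1, c1)) x
       (geval e (update h i (Some x)) s)) ->
    exists2 d0, geval e h d = Some d0 & forall x,
      elt (geval e (update h i (Some x)) s) (geval e (update h i (Some x)) t) =
      (x *~ (k1 * n2.+1%:Z - k2 * n1.+1%:Z) < d0).
  move=> lt ls; have [d2 [_ [c2E _ _]]] := lt 0; have [d1 [_ [c1E _ _]]] := ls 0.
  exists (d2 *+ n1.+1 - d1 *+ n2.+1).
    by rewrite geval_GSub !geval_gmul c1E c2E !nmulE.
  move=> x; have [d1' [z1 []]] := ls x; have [d2' [z2 []]] := lt x.
  rewrite c1E c2E => -[<-] -> z2E [<-] -> z1E; rewrite /elt.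
  rewrite -(og_ltr_Mn (den n1 n2)) denE.
  rewrite (lin_scale _ z1E) mulnC (lin_scale _ z2E) mulrzBr.
  rewrite -(og_ltD2r (- (d1 *+ n2.+1) - x *~ (k2 * n1.+1%:Z))).
  congr (_ < _); first by rewrite addrACA subrr add0r.
  by rewrite addrACA subrr addr0.
(* By the sign of the slope: a condition on the parameters, an upper bound, or a lower bound, the
   last slope being [-(m + 1)]. *)
move: d (k1 * n2.+1%:Z - k2 * n1.+1%:Z) key => d [[|m]|m] key.
- apply: (pw_leaf (t := [:: (GLt GZero d, [::])])) => M e h lt ls.
  split=> // x; have [d0 dE ->] := key M e h lt ls.
  by rewrite mulr0z /= dE; split=> [h0|[[]|]//]; left.
- apply: (pw_leaf (t := [:: (Not Bot, [:: CLt (GDiv m d)])])) => M e h lt ls.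
  split=> // x; have [d0 dE ->] := key M e h lt ls.
  rewrite [nfholds _ _ _ _]/= dE /=.
  rewrite -pmulrn -{1}[d0](@acvf_divP _ _ M m.+1) // og_ltr_Mn.
  by rewrite /elt; split=> [lt_xd|]; [left; split=> // -[] | case=> [[_ []]|]].
- apply: (pw_leaf (t := [:: (Not Bot, [:: CGt (GDiv m (GSub GZero d))])])) => M e h lt ls.
  split=> // x; have [d0 dE ->] := key M e h lt ls.
  rewrite [nfholds _ _ _ _]/= dE /=.
  rewrite NegzE mulrNz -pmulrn sub0r -og_ltrN2 opprK.
  rewrite -{1}[- d0](@acvf_divP _ _ M m.+1) // og_ltr_Mn.
  by rewrite /elt; split=> [lt_xd|]; [left; split=> // -[] | case=> [[_ []]|]].
Qed.

Lemma tame_formula i phi : quantifier_free phi ->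
  @tame p q (fun M e h x => holds e (update h i (Some x)) phi).
Proof.
elim: phi => //=.
- by move=> s t _; apply: tame_qf; apply: (qfd_formula _ (phi := FEq s t)).
- move=> s t _; apply: tame_ext (tame_and (tame_not (tame_lt i s t))
    (tame_not (tame_lt i t s))) => M e h x.
  by split=> [[/negP lst /negP lts]|/eqP]; [apply/eqP|];
    rewrite elt_neq ?lst // => /andP[/negP + /negP].
- by move=> s t _; apply: tame_lt.
- by move=> _; apply: tame_qf; apply: qfd_False.
- by move=> f IH qf; apply/tame_not/IH.
- by move=> f IHf g IHg /andP[/IHf fP /IHg gP]; apply: tame_and.
- by move=> f IHf g IHg /andP[/IHf fP /IHg gP]; apply: tame_or.
- by move=> f IHf g IHg /andP[/IHf fP /IHg gP]; apply: tame_imp.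
Qed.

Lemma qfdef_gex i (P : relation p q) : qfdef P ->
  qfdef (fun M e h => exists a, P M e (update h i a)).
Proof.
move=> [phi [qphi phiP]].
have eqf := qfdef_ex_tame (tame_formula i qphi).
pose s j := if j == i then GInfty else GVar j.
have := qfdef_subst s (qfd_formula (fun (_ : acvf p q) _ _ => True) qphi) => sqf.
apply: qfdef_ext (qfd_or eqf sqf) => M e h.
have -> : (fun j => geval e h (s j)) = update h i None.
  by apply: functional_extensionality => j; rewrite /s /update; case: eqP.
split=> [[[x xP]|nP]|[[x|] xP]].
- by exists (Some x); apply/phiP.
- by exists None; apply/phiP.
- by left; exists x; apply/phiP.
- by right; apply/phiP.
Qed.

End LinearTerms.

(** * Definable families *)

Section Families.
Variables p q : nat.

(** Coding two environments in one keeps the extra variables apart from the given ones, with no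
    bound on either. *)
Definition evens T (g : nat -> T) i := g i.*2.
Definition odds T (g : nat -> T) i := g i.*2.+1.
Definition interleave T (h z : nat -> T) i := if odd i then z i./2 else h i./2.

Lemma evens_interleave T (h z : nat -> T) : evens (interleave h z) = h.
Proof.
apply: functional_extensionality => i.
by rewrite /evens /interleave odd_double doubleK.
Qed.

Lemma odds_interleave T (h z : nat -> T) : odds (interleave h z) = z.
Proof.
apply: functional_extensionality => i.
by rewrite /odds /interleave /= odd_double uphalf_double.
Qed.

Lemma geval_support t : exists n, forall (M : acvf p q) (e : nat -> M) g g',
  (forall i, (i < n)%N -> g i = g' i) -> geval e g t = geval e g' t.
Proof.
elim: t => [i|||s [m IHs] t [n IHt]|s [m IHs] t [n IHt]|k t [n IHt]|t].
- by exists i.+1 => M e g g'; apply.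
- by exists 0%N.
- by exists 0%N.
- exists (maxn m n) => M e g g' gg' /=.
  by rewrite (IHs M e g g') ?(IHt M e g g') // => i lti; apply: gg';
    rewrite leq_max lti ?orbT.
- exists (maxn m n) => M e g g' gg' /=.
  by rewrite (IHs M e g g') ?(IHt M e g g') // => i lti; apply: gg';
    rewrite leq_max lti ?orbT.
- by exists n => M e g g' gg' /=; rewrite (IHt M e g g').
- by exists 0%N.
Qed.

Lemma holds_support f : quantifier_free f ->
  exists n, forall (M : acvf p q) (e : nat -> M) g g',
  (forall i, (i < n)%N -> g i = g' i) -> (holds e g f <-> holds e g' f).
Proof.
elim: f => //=.
- by exists 0%N.
- move=> s t _; have [m sP] := geval_support s; have [n tP] := geval_support t.
  exists (maxn m n) => M e g g' gg'.
  by rewrite (sP M e g g') ?(tP M e g g') // => i lti; apply: gg';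
    rewrite leq_max lti ?orbT.
- move=> s t _; have [m sP] := geval_support s; have [n tP] := geval_support t.
  exists (maxn m n) => M e g g' gg'.
  by rewrite (sP M e g g') ?(tP M e g g') // => i lti; apply: gg';
    rewrite leq_max lti ?orbT.
- by exists 0%N.
- by move=> f IH /IH[n fP]; exists n => M e g g' /fP fE; rewrite fE.
- move=> f IHf g IHg /andP[/IHf[m fP] /IHg[n gP]].
  exists (maxn m n) => M e h h' hh'.
  by rewrite (fP M e h h') ?(gP M e h h') // => i lti; apply: hh';
    rewrite leq_max lti ?orbT.
- move=> f IHf g IHg /andP[/IHf[m fP] /IHg[n gP]].
  exists (maxn m n) => M e h h' hh'.
  by rewrite (fP M e h h') ?(gP M e h h') // => i lti; apply: hh';
    rewrite leq_max lti ?orbT.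
- move=> f IHf g IHg /andP[/IHf[m fP] /IHg[n gP]].
  exists (maxn m n) => M e h h' hh'.
  by rewrite (fP M e h h') ?(gP M e h h') // => i lti; apply: hh';
    rewrite leq_max lti ?orbT.
Qed.

Local Notation relation2 := (forall M : acvf p q, (nat -> M) ->
  (nat -> option (vf_group M)) -> (nat -> option (vf_group M)) -> Prop).

(* Families of extra variables of the value group sort sit at the odd indices. *)
Definition qfdef2 (Q : relation2) :=
  qfdef (fun M e g => Q M e (evens g) (odds g)).

(** A defining formula mentions finitely many variables, so the quantifier over an infinite family
    amounts to finitely many quantifiers at odd indices. *)
Lemma qfdef_exf (Q : relation2) : qfdef2 Q ->
  qfdef (fun M e h => exists z, Q M e h z).
Proof.
move=> [psi [qpsi psiP]].
(* Only the entries at odd indices below [n] have been quantified. *)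
pose E n (M : acvf p q) (e : nat -> M) g := exists2 g',
  (forall i, ~~ (odd i && (i < n)%N) -> g' i = g i) & holds e g' psi.
have EP n : qfdef (@E n).
  elim: n => [|n IH].
    apply: qfdef_ext (qfd_formula _ qpsi) => M e g.
    split=> [gP|[g' g'E g'P]]; first by exists g.
    suff -> : g = g' by [].
    by apply: functional_extensionality => i; rewrite g'E // ltn0 andbF.
  have [on|en] := boolP (odd n); last first.
    apply: qfdef_ext IH => M e g.
    split=> -[g' g'E g'P]; exists g' => // i iP; apply: g'E; apply: contra iP.
      by move=> /andP[-> /leqW].
    move=> /andP[oi]; rewrite ltnS leq_eqVlt => /orP[/eqP ein|->];
      last by rewrite oi.
    by rewrite -ein oi in en.
  apply: qfdef_ext (qfdef_gex n IH) => M e g; split.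
    move=> [a [g' g'E g'P]]; exists g' => // i iP.
    rewrite g'E /update; last by apply: contra iP => /andP[-> /leqW].
    by case: eqP iP => // ->; rewrite on ltnSn.
  move=> [g' g'E g'P]; exists (g' n), g' => // i iP; rewrite /update.
  case: eqP => [->//|/eqP ne]; apply: g'E; apply: contra iP => /andP[->].
  by rewrite ltnS leq_eqVlt (negPf ne).
have [n nP] := holds_support qpsi.
(* Back to the original numbering; the entries at odd indices, quantified or irrelevant by now, are
   set to 0. *)
pose s i := if odd i then GZero else GVar i./2.
apply: qfdef_ext (qfdef_subst s (EP n)) => M e h.
have sE : (fun i => geval e h (s i)) = interleave h (fun=> Some 0).
  by apply: functional_extensionality => i; rewrite /s /interleave; case: ifP.
rewrite sE; split=> [[g' g'E g'P]|[z zP]].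
  exists (odds g'); have -> : h = evens g'; last exact/psiP.
  apply: functional_extensionality => i.
  by rewrite /evens g'E ?odd_double // /interleave odd_double doubleK.
(* The witness has to agree with the zero family from [n] on, where [psi] does not look. *)
pose g i := if odd i && (n <= i)%N then Some 0 else interleave h z i.
exists g => [i|].
  rewrite /g /interleave; case: (odd i) => //=.
  by rewrite -leqNgt => ->.
apply/(nP M e (interleave h z)).
  by move=> i ltin; rewrite /g leqNgt ltin andbF.
by apply/psiP => //; rewrite evens_interleave odds_interleave.
Qed.

Lemma qfdef_allf (Q : relation2) : qfdef2 Q ->
  qfdef (fun M e h => forall z, Q M e h z).
Proof.
move=> QP; have := qfdef_exf (Q := fun M e h z => ~ Q M e h z) (qfd_not QP).
move/qfd_not; apply: qfdef_ext => M e h; split=> [nex z|all [z]].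
  by apply: NNPP => nQ; apply: nex; exists z.
exact.
Qed.

Lemma qfdef2_right (P : relation p q) : qfdef P ->
  qfdef2 (fun M e _ z => P M e z).
Proof. by move/(qfdef_subst (fun i => GVar i.*2.+1)). Qed.

End Families.

(** * Polynomials and matrices whose coefficients are terms *)

Section DefinablePolynomials.
Variables p q : nat.
Local Notation tdef := (@tdef p q).

Lemma tdef_ext f g : (forall M e, f M e = g M e) -> tdef f -> tdef g.
Proof. by move=> fg [t tP]; exists t => M e; rewrite tP. Qed.

Lemma tdef_0 : tdef (fun _ _ => 0).
Proof. by exists FZero. Qed.

Lemma tdef_1 : tdef (fun _ _ => 1).
Proof. by exists FOne. Qed.

Lemma tdef_add f g : tdef f -> tdef g -> tdef (fun M e => f M e + g M e).
Proof. by move=> [s sP] [t tP]; exists (FAdd s t) => M e /=; rewrite sP tP. Qed.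

Lemma tdef_mul f g : tdef f -> tdef g -> tdef (fun M e => f M e * g M e).
Proof. by move=> [s sP] [t tP]; exists (FMul s t) => M e /=; rewrite sP tP. Qed.

Lemma tdef_opp f : tdef f -> tdef (fun M e => - f M e).
Proof.
by move=> [s sP]; exists (FSub FZero s) => M e /=; rewrite sP sub0r.
Qed.

Lemma tdef_mulrn f n : tdef f -> tdef (fun M e => f M e *+ n).
Proof.
move=> fP; elim: n => [|n IH]; first exact: tdef_0.
by apply: tdef_ext (tdef_add fP IH) => M e; rewrite mulrS.
Qed.

Lemma tdef_exp f n : tdef f -> tdef (fun M e => f M e ^+ n).
Proof.
move=> fP; elim: n => [|n IH]; first exact: tdef_1.
by apply: tdef_ext (tdef_mul fP IH) => M e; rewrite exprS.
Qed.

Lemma tdef_sum (I : Type) (r : seq I) f : (forall i, tdef (f i)) ->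
  tdef (fun M e => \sum_(i <- r) f i M e).
Proof.
move=> fP; elim: r => [|i r IH].
  by apply: tdef_ext tdef_0 => M e; rewrite big_nil.
by apply: tdef_ext (tdef_add (fP i) IH) => M e; rewrite big_cons.
Qed.

(** The size bound is common to all models and environments, so that conditions on all coefficients
    are finite conjunctions fixed in advance. *)
Definition pdef (f : forall M : acvf p q, (nat -> M) -> {poly M}) :=
  (exists n, forall M e, (size (f M e) <= n)%N) /\
  forall i, tdef (fun M e => (f M e)`_i).

Lemma pdef_ext f g : (forall M e, f M e = g M e) -> pdef f -> pdef g.
Proof.
move=> fg [[n nP] cP]; split; first by exists n => M e; rewrite -fg.
by move=> i; apply: tdef_ext (cP i) => M e; rewrite fg.
Qed.

Lemma pdefC f : tdef f -> pdef (fun M e => (f M e)%:P).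
Proof.
move=> fP; split; first by exists 1%N => M e; rewrite size_polyC leq_b1.
case=> [|i]; first by apply: tdef_ext fP => M e; rewrite coefC.
by apply: tdef_ext tdef_0 => M e; rewrite coefC.
Qed.

Lemma pdefX : pdef (fun M e => 'X).
Proof.
split; first by exists 2 => M e; rewrite size_polyX.
move=> i; have [->|/negPf ne] := eqVneq i 1%N.
  by apply: tdef_ext tdef_1 => M e; rewrite coefX.
by apply: tdef_ext tdef_0 => M e; rewrite coefX ne.
Qed.

Lemma pdef_add f g : pdef f -> pdef g -> pdef (fun M e => f M e + g M e).
Proof.
move=> [[m mP] fP] [[n nP] gP]; split.
  exists (maxn m n) => M e; apply: leq_trans (size_polyD _ _) _.
  by rewrite geq_max !leq_max mP nP orbT.
by move=> i; apply: tdef_ext (tdef_add (fP i) (gP i)) => M e; rewrite coefD.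
Qed.

Lemma pdef_mul f g : pdef f -> pdef g -> pdef (fun M e => f M e * g M e).
Proof.
move=> [[m mP] fP] [[n nP] gP]; split.
  exists (m + n)%N => M e; apply: leq_trans (size_polyMleq _ _) _.
  by apply: leq_trans (leq_pred _) _; apply: leq_add.
move=> i; pose F (j : 'I_i.+1) (M : acvf p q) (e : nat -> M) :=
  (f M e)`_j * (g M e)`_(i - j).
have FP j : tdef (F j) by apply: tdef_mul.
by apply: tdef_ext (tdef_sum _ FP) => M e; rewrite coefM.
Qed.

Lemma pdef_opp f : pdef f -> pdef (fun M e => - f M e).
Proof.
move=> fP; apply: pdef_ext (pdef_mul (pdefC (tdef_opp tdef_1)) fP) => M e.
by rewrite polyCN mulN1r.
Qed.

Lemma pdef_exp f n : pdef f -> pdef (fun M e => f M e ^+ n).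
Proof.
move=> fP; elim: n => [|n IH]; first by apply: (pdefC tdef_1).
by apply: pdef_ext (pdef_mul fP IH) => M e; rewrite exprS.
Qed.

Lemma pdef_sum (I : Type) (r : seq I) f : (forall i, pdef (f i)) ->
  pdef (fun M e => \sum_(i <- r) f i M e).
Proof.
move=> fP; elim: r => [|i r IH].
  by apply: pdef_ext (pdefC tdef_0) => M e; rewrite big_nil.
by apply: pdef_ext (pdef_add (fP i) IH) => M e; rewrite big_cons.
Qed.

Lemma pdef_prod (I : Type) (r : seq I) f : (forall i, pdef (f i)) ->
  pdef (fun M e => \prod_(i <- r) f i M e).
Proof.
move=> fP; elim: r => [|i r IH].
  by apply: pdef_ext (pdefC tdef_1) => M e; rewrite big_nil.
by apply: pdef_ext (pdef_mul (fP i) IH) => M e; rewrite big_cons.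
Qed.

Lemma pdef_det n (A : forall M : acvf p q, (nat -> M) -> 'M[{poly M}]_n) :
  (forall i j, pdef (fun M e => A M e i j)) -> pdef (fun M e => \det (A M e)).
Proof.
move=> AP; apply: pdef_sum => s; apply: pdef_mul.
  by apply: pdef_exp; apply: pdef_opp; apply: pdefC; apply: tdef_1.
exact: pdef_prod.
Qed.

(** These derivatives are already divided by [n!]: their coefficients are binomial multiples,
    meaningful even if [n!] vanishes in the field. *)
Lemma pdef_nderivn f n : pdef f -> pdef (fun M e => (f M e)^`N(n)).
Proof.
move=> [[m mP] fP]; split.
  exists m => M e; apply/leq_sizeP => i le_mi; rewrite coef_nderivn.
  by rewrite (leq_sizeP _ _ (mP M e)) ?mul0rn // (leq_trans le_mi) ?leq_addl.
move=> i; apply: tdef_ext (tdef_mulrn 'C(n + i, n) (fP (n + i)%N)) => M e.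
by rewrite coef_nderivn.
Qed.

Definition mdef m n (A : forall M : acvf p q, (nat -> M) -> 'M[M]_(m, n)) :=
  forall i j, tdef (fun M e => A M e i j).

Lemma mdef_mul m n l A B : @mdef m n A -> @mdef n l B ->
  mdef (fun M e => A M e *m B M e).
Proof.
move=> AP BP i j.
pose F (k : 'I_n) (M : acvf p q) (e : nat -> M) := A M e i k * B M e k j.
have FP k : tdef (F k) by apply: tdef_mul.
by apply: tdef_ext (tdef_sum _ FP) => M e; rewrite !mxE.
Qed.

Lemma mdef_exp n A k : @mdef n.+1 n.+1 A -> mdef (fun M e => A M e ^+ k).
Proof.
move=> AP; elim: k => [|k IH].
  move=> i j; apply: tdef_ext (tdef_mulrn (i == j) tdef_1) => M e.
  by rewrite expr0 mxE.
move=> i j; apply: tdef_ext (mdef_mul AP IH i j) => M e.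
by rewrite exprS.
Qed.

End DefinablePolynomials.

(** * Gauss norms *)

Section Valuations.
Variable K : valuedField.
Local Notation v := (@vf_val K).
Implicit Types (x y b : K) (F G : {poly K}).

Lemma val_eq0 x : (v x == None) = (x == 0).
Proof. by apply/eqP/eqP => /val_eq_infty. Qed.

Lemma ele_valD c x y : ele c (v x) -> ele c (v y) -> ele c (v (x + y)).
Proof.
by move=> cx cy; apply: ele_trans (valD x y); rewrite ele_emin cx.
Qed.

Lemma valBC x y : v (x - y) = v (y - x).
Proof. by rewrite -valN opprB. Qed.

Lemma valDl x y : elt (v x) (v y) -> v (x + y) = v x.
Proof.
move=> xy; apply: ele_anti; last by apply: ele_valD (ele_refl _) (eltW xy).
have := valD (x + y) (- y); rewrite addrK valN /emin.
by case: ifP => // _ /(elt_le_trans xy); rewrite eltNele ele_refl.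
Qed.

Lemma valX x n : v (x ^+ n) = nmul n (v x).
Proof.
by elim: n => [|n IH]; [rewrite expr0 val1 | rewrite exprS valM IH].
Qed.

Lemma val_prod (I : Type) (r : seq I) (f : I -> K) :
  v (\prod_(i <- r) f i) = \big[@eadd _/Some 0]_(i <- r) v (f i).
Proof. exact: (big_morph v (@valM K) (val1 K)). Qed.

Definition gauss F := \big[@emin _/None]_(i < size F) v F`_i.

Lemma gaussP c F : reflect (forall i, ele c (v F`_i)) (ele c (gauss F)).
Proof.
apply: (iffP (ele_bigminP _ (fun i => v F`_i) _)) => cF i //.
have [|le_Fi] := ltnP i (size F); first exact: cF.
by rewrite nth_default // val0 ele_None.
Qed.

Lemma gauss_le F i : ele (gauss F) (v F`_i).
Proof. by move: i; apply/gaussP/ele_refl. Qed.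

Lemma gauss_attained F : exists i, gauss F = v F`_i.
Proof.
rewrite /gauss; case: (bigmin_attained (size F) (fun i => v F`_i)) => [->|[i]].
  by exists (size F); rewrite nth_default // val0.
by exists i.
Qed.

Lemma gauss_wide n F : (size F <= n)%N ->
  gauss F = \big[@emin _/None]_(i < n) v F`_i.
Proof.
move=> le_Fn; apply: ele_eq => c.
apply/gaussP/(ele_bigminP _ (fun i => v F`_i)) => cF i //.
have [|le_ni] := ltnP i n; first exact: cF.
by rewrite nth_default ?val0 ?ele_None // (leq_trans le_Fn).
Qed.

Lemma gaussC c : gauss c%:P = v c.
Proof. by rewrite (gauss_wide (size_polyC_leq1 c)) big_ord1 coefC. Qed.

Lemma gaussCM c F : gauss (c%:P * F) = eadd (v c) (gauss F).
Proof.
apply: ele_anti.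
  have [i ->] := gauss_attained F.
  by have := gauss_le (c%:P * F) i; rewrite coefCM valM.
by apply/gaussP => i; rewrite coefCM valM ele_add2l ?gauss_le.
Qed.

Lemma gauss_neq0 F : F != 0 -> exists g, gauss F = Some g.
Proof.
move=> F0; case E: (gauss F) => [g|]; first by exists g.
have := gauss_le F (size F).-1; rewrite E; case L: (v _) => [//|] _.
by move/eqP: L; rewrite val_eq0 -lead_coefE lead_coef_eq0 (negPf F0).
Qed.

Lemma coef_XsubCM b F i :
  (('X - b%:P) * F)`_i = (if i is j.+1 then F`_j else 0) - b * F`_i.
Proof. by rewrite mulrBl coefB coefXM coefCM; case: i. Qed.

(** One coefficient of the product attains the bound. If [0 <= v b], it is the one just after the
    last index where [F] has minimal valuation; if [v b < 0], it is the one at the first such index,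
    where the contribution of [b] dominates. *)
Lemma gauss_XsubCM b F :
  gauss (('X - b%:P) * F) = eadd (emin (Some 0) (v b)) (gauss F).
Proof.
have [->|F0] := eqVneq F 0; first by rewrite mulr0 gaussC val0 eaddNone.
have [g gF] := gauss_neq0 F0.
apply: ele_anti; last first.
  apply/gaussP => i; rewrite coef_XsubCM; apply: ele_valD; last first.
    rewrite valN valM; apply: ele_trans (ele_add2l _ (gauss_le F i)).
    by rewrite ![eadd _ (gauss F)]eaddC ele_add2l // eminC /emin;
      case: ifPn => [_|]; rewrite ?ele_refl // -eleNelt.
  case: i => [|j]; first by rewrite val0 ele_None.
  apply: ele_trans (gauss_le F j); rewrite -{2}[gauss F]eadd0.
  rewrite ![eadd _ (gauss F)]eaddC ele_add2l // /emin.
  by case: ifPn => [_|]; rewrite ?ele_refl // -eleNelt.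
have exi : exists i, v F`_i == gauss F.
  by have [i ->] := gauss_attained F; exists i.
have gt_g i : v F`_i != gauss F -> elt (gauss F) (v F`_i).
  by move=> ne; have := gauss_le F i; rewrite /ele eq_sym (negPf ne).
have [b0|] := boolP (ele (Some 0) (v b)).
  have ub i : v F`_i == gauss F -> (i <= size F)%N.
    by rewrite leqNgt gF; apply: contraL => /ltnW si; rewrite nth_default ?val0.
  case: (ex_maxnP exi ub) => i /eqP vi imax.
  have -> : emin (Some 0) (v b) = Some 0.
    rewrite /emin; case: ifPn => //; rewrite -eleNelt => b1.
    exact: ele_anti b1 b0.
  rewrite eadd0 -vi; have := gauss_le (('X - b%:P) * F) i.+1.
  rewrite coef_XsubCM valDl // valN valM vi.
  have := gt_g i.+1; case: eqP => [/eqP/imax|_ /(_ isT) lt_g].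
    by rewrite ltnn.
  apply: elt_le_trans lt_g _; rewrite -{1}[v F`_i.+1]eadd0.
  by rewrite ![eadd _ (v F`_i.+1)]eaddC ele_add2l.
rewrite -eltNele => b0.
case: (ex_minnP exi) => i /eqP vi imin.
have -> : emin (Some 0) (v b) = v b by rewrite eminC /emin b0.
rewrite -vi -valM -valN; have := gauss_le (('X - b%:P) * F) i.
rewrite coef_XsubCM [_ - b * _]addrC valDl //.
rewrite valN valM vi; case: i {imin} vi => [_|i _].
  by rewrite val0 gF; case: (v b) b0.
apply: elt_le_trans (gauss_le F i); rewrite -{2}[gauss F]eadd0 gF.
by rewrite ![eadd _ (Some g)]eaddC elt_add2l.
Qed.

Hypothesis closedK : GRing.closed_field_axiom K.

Lemma poly_ext F G : (forall x, F.[x] = G.[x]) -> F = G.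
Proof.
move=> FG; apply/eqP; rewrite -subr_eq0.
case: (altP (F - G =P 0)) => // /(PreClosedField.closed_nonrootP closedK)[x].
by rewrite /root hornerD hornerN FG subrr eqxx.
Qed.

Lemma closed_split F :
  exists rs, F = lead_coef F *: \prod_(b <- rs) ('X - b%:P).
Proof.
elim: {F}(size F) {-2}F (leqnn (size F)) => [|n IH] F.
  by rewrite leqn0 size_poly_eq0 => /eqP->; exists [::]; rewrite lead_coef0 scale0r.
move=> szF; have [|] := boolP (size F == 1%N).
  move=> /size_poly1P[c _ ->]; exists [::].
  by rewrite big_nil lead_coefC alg_polyC.
move/(PreClosedField.closed_rootP closedK) => [x /factor_theorem[G GE]].
have [G0|G0] := eqVneq G 0.
  by exists [::]; rewrite GE G0 mul0r lead_coef0 scale0r.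
have szG : (size G <= n)%N.
  by move: szF; rewrite GE size_Mmonic ?monicXsubC // size_XsubC addn2.
have [rs rsE] := IH G szG; exists (x :: rs).
rewrite big_cons GE lead_coef_Mmonic ?monicXsubC // {1}rsE.
by rewrite -scalerAl mulrC.
Qed.

(** Take [x * prod (x - b) = 1] over the [b] with [0 <= v b]. If [v x < 0], all factors have
    valuation [v x] and the total could not be 0. So [0 <= v x], all factors have nonnegative
    valuations of sum 0, and each of these is 0. The other [b] dominate [x]. *)
Lemma unit_away (rs : seq K) : exists x, v x = Some 0 /\
  forall b, b \in rs -> v (x - b) = emin (Some 0) (v b).
Proof.
pose s := [seq b <- rs | ele (Some 0) (v b)].
(* The factor ['X] forces [v x = 0] and makes [f] nonconstant even if [s] is empty. *)
pose f : {poly K} := 'X * \prod_(b <- s) ('X - b%:P) - 1.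
have : size f != 1%N.
  have szs : size ('X * \prod_(b <- s) ('X - b%:P) : {poly K}) = (size s).+2.
    rewrite size_monicM ?monicX ?monic_neq0 ?monic_prod_XsubC //.
    by rewrite size_polyX size_prod_XsubC.
  by rewrite /f size_polyDl ?szs // size_polyN size_poly1.
case/(PreClosedField.closed_rootP closedK) => x.
rewrite /root !hornerE horner_prod => fx.
have {fx} : v (x * \prod_(b <- s) (x - b)) = Some 0.
  rewrite -(val1 K); congr v; apply/eqP; move: fx; rewrite subr_eq0.
  by under eq_bigr do rewrite hornerXsubC.
rewrite valM val_prod => x1.
have s0 b : b \in s -> ele (Some 0) (v b) by rewrite mem_filter => /andP[].
have x0 : ele (Some 0) (v x).
  rewrite eleNelt; apply/negP => x_lt0.
  suff : elt (Some 0) (Some 0 : option (vf_group K)) by rewrite /= ltxx.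
  rewrite -{1}x1; apply: (ele_lt_trans _ x_lt0); rewrite -[X in ele _ X]eadd0.
  rewrite [eadd (Some 0) _]eaddC ele_add2l //.
  elim: s s0 {x1 f} => [|b s IH] s0; first by rewrite big_nil ele_refl.
  rewrite big_cons valDl ?valN; last first.
    by apply: (elt_le_trans x_lt0); apply: s0; rewrite mem_head.
  apply: ele_trans (_ : ele (eadd (v x) (Some 0)) _).
    by apply/ele_add2l/IH => c cs; apply: s0; rewrite inE cs orbT.
  by rewrite eaddC eadd0 eltW.
have both0 (a c : option (vf_group K)) : ele (Some 0) a -> ele (Some 0) c ->
    eadd a c = Some 0 -> a = Some 0 /\ c = Some 0.
  move=> a0 c0 ac; split; apply: ele_anti => //; rewrite -ac.
    by rewrite -{1}[a]eadd0 eaddC ele_add2l.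
  by rewrite -{1}[c]eadd0 ![eadd _ c]eaddC ele_add2l.
have s_ge0 b : b \in s -> ele (Some 0) (v (x - b)).
  by move=> /s0 b0; apply: ele_valD; rewrite ?valN.
have prod_ge0 t : {subset t <= s} ->
    ele (Some 0) (\big[@eadd _/Some 0]_(b <- t) v (x - b)).
  elim: t => [|b t IH] ts; first by rewrite big_nil ele_refl.
  rewrite big_cons -[X in ele X _](@eadd0 (vf_group K)).
  apply: ele_trans (_ : ele (eadd (Some 0) (\big[@eadd _/Some 0]_(b <- t) v (x - b))) _).
    by apply/ele_add2l/IH => c ct; apply: ts; rewrite inE ct orbT.
  rewrite ![eadd _ (\big[_/_]_(_ <- _) _)]eaddC ele_add2l //.
  by apply/s_ge0/ts; rewrite mem_head.
have [vx0 vp0] := both0 _ _ x0 (prod_ge0 s (fun b bs => bs)) x1.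
exists x; split=> // b brs.
have [b0|] := boolP (ele (Some 0) (v b)); last first.
  rewrite -eltNele => b0; rewrite addrC valDl ?valN ?vx0 //.
  by rewrite eminC /emin b0.
have -> : emin (Some 0) (v b) = Some 0.
  rewrite /emin; case: ifPn => //; rewrite -eleNelt => b1.
  exact: ele_anti b1 b0.
have bs : b \in s by rewrite mem_filter b0.
suff all0 t : {subset t <= s} ->
    \big[@eadd _/Some 0]_(c <- t) v (x - c) = Some 0 -> b \in t ->
    v (x - b) = Some 0 by exact: (all0 s).
elim: t => // c t IH ts; rewrite big_cons inE => tp bct.
have ts' : {subset t <= s} by move=> d dt; apply: ts; rewrite inE dt orbT.
have [||vc vt] := both0 _ _ _ _ tp; first by apply/s_ge0/ts; rewrite mem_head.
  exact: prod_ge0.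
by case/orP: bct => [/eqP->//|]; apply: IH.
Qed.

(* Gauss's lemma follows, valuations of values at [x] being additive. *)
Lemma gauss_generic (Fs : seq {poly K}) : exists x, v x = Some 0 /\
  forall F, F \in Fs -> v F.[x] = gauss F.
Proof.
suff [rs rsP] : exists rs : seq K, forall x,
    (forall b, b \in rs -> v (x - b) = emin (Some 0) (v b)) ->
    forall F, F \in Fs -> v F.[x] = gauss F.
  by have [x [x0 xP]] := unit_away rs; exists x; split=> //; apply: rsP.
elim: Fs => [|F Fs [rs IH]]; first by exists [::].
have [ts FE] := closed_split F; exists (ts ++ rs) => x xP G.
rewrite inE => /orP[/eqP->{G}|]; last first.
  by apply: IH => b brs; apply: xP; rewrite mem_cat brs orbT.
rewrite FE hornerZ -mul_polyC gaussCM valM; congr eadd.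
have {xP} : forall b, b \in ts -> v (x - b) = emin (Some 0) (v b).
  by move=> b bts; apply: xP; rewrite mem_cat bts.
elim: ts {FE} => [|b ts IHt] xP; first by rewrite !big_nil hornerC gaussC.
rewrite !big_cons hornerM hornerXsubC valM gauss_XsubCM xP ?mem_head //.
by rewrite IHt // => c cts; apply: xP; rewrite inE cts orbT.
Qed.

Lemma gaussM F G : gauss (F * G) = eadd (gauss F) (gauss G).
Proof.
have [x [_ xP]] := gauss_generic [:: F; G; F * G].
by rewrite -!xP ?inE ?eqxx ?orbT // hornerM valM.
Qed.

Lemma gauss_prod (I : Type) (r : seq I) (f : I -> {poly K}) :
  gauss (\prod_(i <- r) f i) = \big[@eadd _/Some 0]_(i <- r) gauss (f i).
Proof.
by apply: (big_morph gauss gaussM); rewrite gaussC val1.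
Qed.

(* The minimum of the valuation of [F] on the ball of center [a] and radius
   [v c], which is also its value at a generic point of that ball. *)
Definition ball_min n F a d :=
  \big[@emin _/None]_(i < n) eadd (v F^`N(i).[a]) (nmul i d).

Definition recenter n F a c : {poly K} := \poly_(i < n) (F^`N(i).[a] * c ^+ i).

Lemma gauss_recenter n F a c : gauss (recenter n F a c) = ball_min n F a (v c).
Proof.
rewrite (gauss_wide (size_poly _ _)); apply: eq_bigr => i _.
by rewrite coef_poly ltn_ord valM valX.
Qed.

Lemma horner_recenter n F a c x : (size F <= n)%N ->
  (recenter n F a c).[x] = F.[a + c * x].
Proof.
move=> Fn; rewrite (nderiv_taylor_wide _ Fn); last exact: mulrC.
by rewrite horner_poly; apply: eq_bigr => i _; rewrite exprMn mulrA.
Qed.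

Lemma ball_values m n (P : nat -> {poly K}) a c :
    (forall j, (j < m)%N -> (size (P j) <= n)%N) ->
  exists x, forall j, (j < m)%N -> v (P j).[x] = ball_min n (P j) a (v c).
Proof.
move=> Pn.
have [x [_ xP]] := gauss_generic [seq recenter n (P j) a c | j <- iota 0 m].
exists (a + c * x) => j jm.
rewrite -(@horner_recenter n) ?Pn // -gauss_recenter xP //.
by apply: map_f; rewrite mem_iota.
Qed.

(** Up to a constant, [F (a + (x - a) Y)] is the product of the [(x - a) Y + (a - b)] over the roots
    [b]. Such a factor has Gauss valuation [min (v (x - a)) (v (a - b))], which equals [v (x - b)]
    because [b] is no closer to [x] than [a]. *)
Lemma ball_min_split n F a x : (size F <= n)%N ->
    (exists2 rs, F = lead_coef F *: \prod_(b <- rs) ('X - b%:P) &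
      forall b, b \in rs -> ele (v (x - b)) (v (x - a))) ->
  ball_min n F a (v (x - a)) = v F.[x].
Proof.
move=> Fn [rs FE rsP]; rewrite -gauss_recenter.
have -> : recenter n F a (x - a) = (lead_coef F)%:P *
    \prod_(b <- rs) ((x - a)%:P * 'X + (a - b)%:P).
  apply: poly_ext => y; rewrite horner_recenter // [in LHS]FE.
  rewrite hornerZ hornerCM !horner_prod; congr (_ * _).
  apply: eq_bigr => b _.
  by rewrite hornerXsubC hornerD hornerCM hornerX hornerC addrAC addrC.
rewrite gaussCM [in RHS]FE hornerZ valM horner_prod; congr eadd.
rewrite gauss_prod val_prod; apply: eq_big_seq => b brs.
have -> : gauss ((x - a)%:P * 'X + (a - b)%:P) = emin (v (x - a)) (v (a - b)).
  rewrite (@gauss_wide 2); last first.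
    apply: leq_trans (size_polyD _ _) _.
    by rewrite geq_max (leq_trans (size_polyMleq _ _)) ?size_polyX
      ?(leq_trans (size_polyC_leq1 _)) // addn2 /= ltnS size_polyC_leq1.
  rewrite big_ord_recl big_ord1 /= !coefD !coefMX !coefC /= add0r addr0.
  by rewrite eminC.
rewrite hornerXsubC; apply: ele_anti.
  have -> : x - b = (x - a) + (a - b) by rewrite addrA subrK.
  by apply: ele_valD; rewrite ?emin_lel ?emin_ler.
rewrite ele_emin rsP //=.
have -> : a - b = (a - x) + (x - b) by rewrite addrA subrK.
by apply: ele_valD; rewrite ?ele_refl // [v (a - x)]valBC rsP.
Qed.

Lemma max_exists (T : eqType) (f : T -> option (vf_group K)) (s : seq T) (x0 : T) :
  x0 \in s -> exists2 x : T, x \in s & forall y : T, y \in s -> ele (f y) (f x).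
Proof.
elim: s x0 => // x s IH _ _.
case: s IH => [_|y s /(_ y (mem_head _ _)) [z zs zP]].
  by exists x; rewrite ?mem_head // => y; rewrite inE => /eqP->; apply: ele_refl.
have [xz|zx] := orP (ele_total (f x) (f z)).
  exists z; first by rewrite inE zs orbT.
  by move=> t; rewrite inE => /orP[/eqP->//|/zP].
exists x; first exact: mem_head.
move=> t; rewrite inE => /orP[/eqP->|/zP tz]; first exact: ele_refl.
exact: ele_trans zx.
Qed.

Lemma closest_root m n (P : nat -> {poly K}) x :
    (forall j, (j < m)%N -> (size (P j) <= n)%N) ->
    (exists2 j, (j < m)%N & (1 < size (P j))%N) ->
  exists j a c, [/\ (j < m)%N, (1 < size (P j))%N, root (P j) a &
    forall i, (i < m)%N -> v (P i).[x] = ball_min n (P i) a (v c)].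
Proof.
move=> Pn [j0 j0m j0P].
have [L LP LS] : exists2 L : seq K,
    (forall b, b \in L ->
       exists j, [/\ (j < m)%N, (1 < size (P j))%N & root (P j) b]) &
    forall j, (j < m)%N -> exists2 rs, {subset rs <= L} &
      P j = lead_coef (P j) *: \prod_(b <- rs) ('X - b%:P).
  elim: m {j0m Pn} => [|m [L LP LS]]; first by exists [::].
  have [rs rsE] := closed_split (P m).
  (* For [P m = 0] the list [rs] is arbitrary, hence its entries must not compete for the closest
     root. *)
  pose t := if (1 < size (P m))%N then rs else [::].
  exists (t ++ L) => [b|j].
    rewrite mem_cat => /orP[|/LP[j [jm Pj rj]]]; last first.
      by exists j; split; rewrite // ltnS ltnW.
    rewrite /t; case: ifP => // Pm brs; exists m; split=> //.
    rewrite rsE rootZ ?root_prod_XsubC //.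
    by rewrite lead_coef_eq0 -size_poly_gt0 ltnW.
  rewrite ltnS leq_eqVlt => /orP[/eqP->|/LS[us usL usE]]; last first.
    by exists us => // b /usL; rewrite mem_cat orbC => ->.
  exists t => [b|]; first by rewrite mem_cat => ->.
  rewrite /t; case: ifPn => // Pm; rewrite -leqNgt in Pm.
  by rewrite big_nil (size1_polyC Pm) lead_coefC alg_polyC.
have [b0 b0L] : exists b, b \in L.
  have [us usL usE] := LS _ j0m; case: us usL usE => [_ E|b us usL _].
    by move: j0P; rewrite E big_nil alg_polyC size_polyC; case: (_ != 0).
  by exists b; apply: usL; rewrite mem_head.
have [a aL aP] := max_exists (fun b => v (x - b)) b0L.
have [j [jm Pj ra]] := LP _ aL.
exists j, a, (x - a); split=> // i im.
have [us usL usE] := LS _ im.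
by rewrite ball_min_split ?Pn //; exists us => // b /usL/aP.
Qed.

End Valuations.

(** * Recovering vectors from tropical linear forms *)

Section TropicalForms.
Variable V : orderedGroupType.
Hypothesis posV : exists g : V, 0 < g.

(** Truncating at a finite level gives a value in the group, where sums can be cancelled. *)
Definition fmin (x : V) (a : option V) : V :=
  if a is Some y then (if y < x then y else x) else x.

Lemma emin_fmin x a : emin (Some x) a = Some (fmin x a).
Proof.
by case: a => [y|] //; rewrite eminC /emin /=; case: ifP.
Qed.

Lemma fmin_eq x a : ele (Some x) a -> fmin x a = x.
Proof. by case: a => [y|] //; rewrite ele_Some /= og_leNgt => /negPf->. Qed.

Lemma fmin_le x y : y <= x -> fmin x (Some y) = y.
Proof. by rewrite /= le_eqVlt => /orP[/eqP->|->] //; rewrite ltxx. Qed.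

Variable s : nat.
Local Notation vec := {ffun 'I_s -> option V}.

Definition form (u : 'I_s -> option V) (w : vec) :=
  \big[@emin V/None]_(i < s) eadd (u i) (w i).

Definition vle (w x : vec) := [forall i, ele (w i) (x i)].

Lemma vle_anti w x : vle w x -> vle x w -> w = x.
Proof.
by move=> /forallP wx /forallP xw; apply/ffunP => i; apply: ele_anti.
Qed.

Lemma vle_trans x w y : vle w x -> vle x y -> vle w y.
Proof.
by move=> /forallP wx /forallP xy; apply/forallP => i; apply: ele_trans (xy i).
Qed.

Lemma vle_refl w : vle w w.
Proof. by apply/forallP => i; apply: ele_refl. Qed.

Lemma maximal_exists (A : seq vec) : A != [::] ->
  exists2 w, w \in A & forall x, x \in A -> vle w x -> x = w.
Proof.
elim: A => // x A IH _; have [->|/IH[w wA wP]] := eqVneq A [::].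
  by exists x; rewrite ?mem_head // => y; rewrite inE => /eqP.
have [wx|nwx] := boolP (vle w x); last first.
  exists w; first by rewrite inE wA orbT.
  move=> y; rewrite inE => /orP[/eqP->|]; last exact: wP.
  by rewrite (negPf nwx).
exists x; first exact: mem_head.
move=> y; rewrite inE => /orP[/eqP->//|yA xy].
have yw : y = w by apply: wP => //; apply: vle_trans xy.
by apply: vle_anti xy; rewrite yw.
Qed.

(** Take [u = - w]. Where [w i] is infinite, [u i] is [- b] with [b] above all finite coordinates in
    [A], so that only an infinite [x i] yields a nonnegative term. *)
Lemma separating_form (A : seq vec) w : exists u, forall x, x \in A ->
  ele (Some 0) (form u x) = vle w x.
Proof.
pose vals := pmap id (flatten [seq [seq (x : vec) i | i <- enum 'I_s] | x <- A]).
have [b bP] := og_above vals posV.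
exists (fun i => if w i is Some y then Some (- y) else Some (- b)) => x xA.
have key i : ele (Some 0)
    (eadd (if w i is Some y then Some (- y) else Some (- b)) (x i)) =
    ele (w i) (x i).
  case: (w i) => [y|]; case xi: (x i) => [t|] //.
    by rewrite ele_Some [RHS]ele_Some addrC og_subr_ge0.
  rewrite ele_Some addrC og_subr_ge0 og_leNgt bP // mem_pmap map_id.
  apply/flatten_mapP; exists x => //.
  by apply/mapP; exists i; rewrite ?mem_enum.
rewrite /form ele_bigmin; apply/allP/forallP => h i.
  by rewrite -key h ?mem_index_enum.
by move=> _; rewrite key.
Qed.

Lemma mulrn_inj_pos (e : V) m n : 0 < e -> e *+ m = e *+ n -> m = n.
Proof.
move=> e0; wlog le_mn : m n / (m <= n)%N => [th|].
  by case/orP: (leq_total m n) => /th // h /esym /h.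
rewrite -(subnK le_mn) mulrnDr -{1}[e *+ m]add0r => /addIr.
case: (n - m)%N => // k ek; have := og_mulrn_gt0 k e0.
by rewrite -ek ltxx.
Qed.

Lemma count_sum (A : seq vec) (e : V) w :
  \sum_(x <- A) (if x == w then e else 0) = e *+ count_mem w A.
Proof.
elim: A => [|x A IH]; first by rewrite big_nil.
by rewrite big_cons IH /=; case: (x == w); rewrite ?add0r // mulrS.
Qed.

(* The slope of [\sum_(x <- A) fmin t (form u x)] just below [t = 0], for [u]
   separating a maximal [w] from the other vectors, counts [w] in [A]. *)
Lemma forms_determine_vectors (A B : seq vec) : size A = size B ->
    (forall t u, \sum_(x <- A) fmin t (form u x) =
                 \sum_(x <- B) fmin t (form u x)) ->
  perm_eq A B.
Proof.
elim: {A}(size A) {-2}A (erefl (size A)) B => [|n IH] A sA B.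
  by move/size0nil: sA => -> /esym/size0nil->.
rewrite sA => sB AB.
have [|w wAB wmax] := @maximal_exists (A ++ B); first by case: A sA {AB}.
have [u uP] := separating_form (A ++ B) w.
(* With [e] at most the absolute value of every negative [form u x], truncating at 0 or at [- e]
   makes a difference only where the form is nonnegative, that is at [w] by maximality. *)
pose negs := [seq - y | y <- pmap (form u) (A ++ B) & y < 0].
have [|e e0 eP] := @og_pos_below V negs posV.
  move=> _ /mapP[y + ->]; rewrite mem_filter => /andP[y0 _].
  by rewrite -oppr0 og_ltrN2.
have slope x : x \in A ++ B ->
    fmin 0 (form u x) - fmin (- e) (form u x) = if x == w then e else 0.
  move=> xAB; have := uP x xAB; have [->|ne] := eqVneq x w.
    rewrite vle_refl => f0; rewrite fmin_eq // fmin_eq ?sub0r ?opprK //.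
    by apply: ele_trans f0; rewrite ele_Some -oppr0 og_lerN2 ltW.
  have -> : vle w x = false.
    by apply/negP => /(wmax x xAB)/eqP; rewrite (negPf ne).
  case fx: (form u x) => [y|]; last by rewrite ele_None.
  rewrite ele_Some => /negbT; rewrite -og_ltNge => y0.
  have ye : (y <= - e :> V).
    rewrite -(og_lerN2 (- e) y) opprK eP //.
    by apply/map_f; rewrite mem_filter y0 mem_pmap -fx map_f.
  by rewrite (fmin_le (ltW y0)) (fmin_le ye) subrr.
have cnt : count_mem w A = count_mem w B.
  apply: (mulrn_inj_pos e0); rewrite -!count_sum.
  have sl C : {subset C <= A ++ B} -> \sum_(x <- C) (if x == w then e else 0) =
      \sum_(x <- C) fmin 0 (form u x) - \sum_(x <- C) fmin (- e) (form u x).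
    by move=> CAB; rewrite -sumrB; apply: eq_big_seq => x /CAB/slope.
  by rewrite !sl ?AB // => x xC; rewrite mem_cat xC ?orbT.
have wA : w \in A.
  by move: wAB; rewrite mem_cat -!has_pred1 !has_count cnt orbb.
have wB : w \in B by rewrite -has_pred1 has_count -cnt -has_count has_pred1.
have [pA pB] := (perm_to_rem wA, perm_to_rem wB).
rewrite (permPl pA) (permPr pB) perm_cons; apply: IH.
- by rewrite size_rem // sA.
- by rewrite !size_rem // sA sB.
- move=> t v; have := AB t v; rewrite (perm_big _ pA) (perm_big _ pB) !big_cons.
  exact: addrI.
Qed.

End TropicalForms.

(** * Kronecker substitution *)

Section Digits.
Variables (B : nat).

Definition digit i n := ((n %/ B ^ i) %% B)%N.

Lemma digit_sum s (c : nat -> nat) j : (forall i, (c i < B)%N) -> (j < s)%N ->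
  digit j (\sum_(i < s) c i * B ^ i)%N = c j.
Proof.
move=> cB; have B0 : (0 < B)%N by apply: leq_ltn_trans (cB 0%N).
elim: s c j cB => // s IH c j cB js; rewrite big_ord_recl expn0 muln1.
have -> : (\sum_(i < s) c (bump 0 i) * B ^ bump 0 i =
           (\sum_(i < s) c i.+1 * B ^ i) * B)%N.
  by rewrite big_distrl; apply: eq_bigr => i _; rewrite /= expnS mulnCA mulnC.
case: j js => [|j] js; rewrite /digit.
  by rewrite expn0 divn1 addnC modnMDl modn_small.
rewrite expnS divnMA addnC divnMDl // (divn_small (cB 0%N)) addn0.
exact: (IH (fun i => c i.+1)).
Qed.

End Digits.

Section Kronecker.
Variable K : fieldType.

(** In the expanded product, a choice [f] of one term per factor contributes to the exponent
    [sum_k B ^ (f k)]. Its [i]-th digit counts the [k] with [f k = i]: there are at most [d < B] of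
    them, so nothing is carried and the exponent determines the monomial in the [y i]. *)
Lemma kronecker_scale B d s (y : nat -> K) (r : nat -> nat -> K) n : (d < B)%N ->
  (\prod_(k < d) \sum_(i < s) (y i * r k i) *: 'X^(B ^ i))`_n =
  (\prod_(i < s) y i ^+ digit B i n) *
  (\prod_(k < d) \sum_(i < s) r k i *: 'X^(B ^ i))`_n.
Proof.
move=> dB; rewrite !bigA_distr_bigA !coef_sum big_distrr /=.
apply: eq_bigr => f _; rewrite !scaler_prod prodrXr !coefZ coefXn.
have [nE|] := eqVneq; last by rewrite !mulr0.
rewrite !mulr1 big_split /=; congr (_ * _).
rewrite (partition_big f predT) //=; apply: eq_bigr => i _.
rewrite (eq_bigr (fun=> y i)); last by move=> k /eqP->.
rewrite prodr_const; congr (_ ^+ _).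
pose c (i : nat) := #|[pred k : 'I_d | f k == i :> nat]|.
have -> : n = (\sum_(i < s) c i * B ^ i)%N.
  rewrite nE (partition_big f predT) //=; apply: eq_bigr => j _.
  rewrite (eq_bigr (fun=> B ^ j)%N); last by move=> k /eqP->.
  by rewrite sum_nat_const.
rewrite digit_sum //; last first.
  move=> j; apply: leq_ltn_trans dB; apply: leq_trans (max_card _) _.
  by rewrite card_ord.
Qed.

End Kronecker.

(** * Products over the roots of a polynomial *)

Section CompanionDeterminants.
Variable K : fieldType.

Lemma char_poly_companion (F : {poly K}) d : F \is monic -> size F = d.+2 ->
  char_poly (\matrix_(i < d.+1, j < d.+1)
    if (i == d :> nat) then - F`_j else (i.+1 == j :> nat)%:R) = F.
Proof.
move=> Fm Fd.
(* The companion matrix has dimension [(size F).-1]; letting the dimension vary avoids a cast to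
   [d.+1]. *)
have gen n : n = (size F).-1 -> char_poly (\matrix_(i < n, j < n)
    if (i == n.-1 :> nat) then - F`_j else (i.+1 == j :> nat)%:R) = F.
  by move->; apply: companionmxK.
by apply: (gen d.+1); rewrite Fd.
Qed.

(** For [F] of degree [d + 1], the companion matrix of the monic multiple of [F], times the leading
    coefficient: its entries involve no division. *)
Definition scaled_companion (F : {poly K}) d : 'M[K]_d.+1 :=
  \matrix_(i, j) if (i == d :> nat) then - F`_j
                 else F`_d.+1 *+ (i.+1 == j :> nat).

Lemma char_poly_scaled_companion (F : {poly K}) d : size F = d.+2 ->
  char_poly ((F`_d.+1)^-1 *: scaled_companion F d) = (F`_d.+1)^-1 *: F.
Proof.
move=> Fd; have lcF : lead_coef F = F`_d.+1 by rewrite lead_coefE Fd.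
have q0 : F`_d.+1 != 0 by rewrite -lcF lead_coef_eq0 -size_poly_gt0 Fd.
rewrite -[RHS](@char_poly_companion _ d).
- congr char_poly; apply/matrixP => i j; rewrite !mxE.
  case: ifP => _; first by rewrite coefZ mulrN.
  by rewrite mulrnAr mulVf.
- by rewrite monicE lead_coefZ lcF mulVf.
- by rewrite size_scale ?invr_eq0.
Qed.

(** The factor [q ^+ N] absorbs all denominators, as [N] bounds the degree of [F]. *)
Lemma horner_mx_scaled n N (A : 'M[K]_n.+1) q (F : {poly K}) : q != 0 ->
  (size F <= N.+1)%N ->
  horner_mx (q^-1 *: A) (q ^+ N *: F) =
  \sum_(j < N.+1) (F`_j * q ^+ (N - j)) *: A ^+ j.
Proof.
move=> q0 FN; have FE : F = \sum_(j < N.+1) F`_j *: 'X^j.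
  rewrite -poly_def; apply/polyP => i; rewrite coef_poly.
  by case: ltnP => // le_Ni; rewrite nth_default // (leq_trans FN).
rewrite {1}FE linearZ /= linear_sum scaler_sumr; apply: eq_bigr => j _.
rewrite linearZ /= rmorphXn /= horner_mx_X.
rewrite exprZn !scalerA mulrAC; congr (_ *: _).
rewrite exprVn mulrC; congr (_ * _).
by rewrite -{1}(subnK (leq_ord j)) exprD mulfK // expf_eq0 (negPf q0) andbF.
Qed.

Lemma det_sub_scalar n (A : 'M[K]_n) b :
  \det (A - b%:M) = (-1) ^+ n * (char_poly A).[b].
Proof.
have -> : (char_poly A).[b] = \det (b%:M - A).
  rewrite -/(horner_eval b _) /char_poly -det_map_mx; congr (\det _).
  apply/matrixP => i j; rewrite !mxE /= /horner_eval hornerD hornerN hornerC.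
  by rewrite hornerMn hornerX.
by rewrite -opprB -scaleN1r detZ.
Qed.

End CompanionDeterminants.

Section ClosedFieldDeterminants.
Variable K : valuedField.
Local Notation v := (@vf_val K).
Hypothesis closedK : GRing.closed_field_axiom K.

(** [F] splits too, and [det (A - b)] is up to sign the characteristic polynomial at [b]: both sides
    become the double product of the differences [a - b]. *)
Lemma det_horner_mx n (A : 'M[K]_n.+1) (rs : seq K) (F : {poly K}) :
    char_poly A = \prod_(a <- rs) ('X - a%:P) ->
  \det (horner_mx A F) = \prod_(a <- rs) F.[a].
Proof.
move=> charA; have srs : size rs = n.+1.
  by have := size_char_poly A; rewrite charA size_prod_XsubC => -[].
have pow (x : K) : x ^+ n.+1 = \prod_(a <- rs) x.
  by rewrite big_const_seq count_predT iter_mulr_1 srs.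
have [ts FE] := closed_split closedK F; rewrite {}FE; move: (lead_coef F) => c.
rewrite linearZ /= detZ rmorph_prod.
have -> : \prod_(a <- rs) (c *: \prod_(b <- ts) ('X - b%:P)).[a] =
    c ^+ n.+1 * \prod_(b <- ts) \prod_(a <- rs) (a - b).
  rewrite exchange_big pow -big_split /=.
  apply: eq_bigr => a _; rewrite hornerZ horner_prod; congr (_ * _).
  by apply: eq_bigr => b _; rewrite hornerXsubC.
congr (_ * _).
have detprod : {morph (fun B : 'M[K]_n.+1 => \det B) : B C / B * C >-> B * C}.
  by move=> B C; apply: det_mulmx.
rewrite (big_morph _ detprod (det1 _ _)); apply: eq_bigr => b _.
rewrite rmorphB /= horner_mx_X horner_mx_C det_sub_scalar charA horner_prod.
rewrite pow -big_split /=.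
by apply: eq_bigr => a _; rewrite hornerXsubC mulN1r opprB.
Qed.

Lemma gauss_kronecker B s (r : nat -> K) : (1 < B)%N ->
  gauss (\sum_(i < s) r i *: 'X^(B ^ i) : {poly K}) =
  \big[@emin _/None]_(i < s) v (r i).
Proof.
move=> B1; have coefE m : (\sum_(i < s) r i *: 'X^(B ^ i) : {poly K})`_m =
    \sum_(i < s) r i *+ (m == B ^ i)%N.
  rewrite coef_sum; apply: eq_bigr => i _.
  by rewrite coefZ coefXn mulr_natr.
apply: ele_eq => c; apply/gaussP/(ele_bigminP _ (fun i => v (r i))) => cr.
  move=> i lt_is; have := cr (B ^ i)%N; rewrite coefE.
  rewrite (bigD1 (Ordinal lt_is)) //= eqxx big1 ?addr0 // => j ji.
  rewrite eqn_exp2l // eq_sym; case: eqP => // ij; case/eqP: ji.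
  exact: val_inj.
move=> m; rewrite coefE; apply: (big_ind (fun x => ele c (v x))).
- by rewrite val0 ele_None.
- exact: ele_valD.
- by move=> i _; case: eqP => _; rewrite ?mulr1n ?cr // mulr0n val0 ele_None.
Qed.

Lemma val_section : exists y : option (vf_group K) -> K, forall a, v (y a) = a.
Proof.
have ex a : exists x, v x == a by have [x <-] := val_surj (v := K) a; exists x.
by exists (fun a => xchoose (ex a)) => a; apply/eqP/(xchooseP (ex a)).
Qed.

(* Gauss's lemma, applied after rescaling the [i]-th linear form by an element
   of valuation [u i]. *)
Lemma tropical_product B d s N (r : nat -> nat -> K) (u : nat -> option (vf_group K)) :
    (0 < d)%N -> (d < B)%N ->
    (size (\prod_(k < d) \sum_(i < s) r k i *: 'X^(B ^ i) : {poly K})%R <= N)%N ->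
  \big[@emin _/None]_(n < N)
    eadd (v (\prod_(k < d) \sum_(i < s) r k i *: 'X^(B ^ i) : {poly K})`_n)
         (\big[@eadd _/Some 0]_(i < s) nmul (digit B i n) (u i)) =
  \big[@eadd _/Some 0]_(k < d) \big[@emin _/None]_(i < s) eadd (u i) (v (r k i)).
Proof.
move=> d0 dB FN; have [y yP] := val_section.
pose F : {poly K} := \prod_(k < d) \sum_(i < s) (y (u i) * r k i) *: 'X^(B ^ i).
have -> : \big[@eadd _/Some 0]_(k < d)
    \big[@emin _/None]_(i < s) eadd (u i) (v (r k i)) = gauss F.
  rewrite gauss_prod //; apply: eq_bigr => k _.
  rewrite (gauss_kronecker _ (fun i => y (u i) * r k i)); last first.
    exact: leq_ltn_trans d0 dB.
  by apply: eq_bigr => i _; rewrite valM yP.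
have FE n := kronecker_scale s (fun i => y (u i)) r n dB.
rewrite (@gauss_wide _ N); last first.
  apply/leq_sizeP => n le_Nn; rewrite FE.
  by rewrite (leq_sizeP _ _ FN n le_Nn) mulr0.
apply: eq_bigr => n _; rewrite FE valM eaddC; congr eadd.
by rewrite val_prod; apply: eq_bigr => i _; rewrite valX yP.
Qed.

End ClosedFieldDeterminants.

(** * Elimination of a root *)

Section RootElimination.
Variables p q : nat.
Local Notation family := (forall M : acvf p q, (nat -> M) -> {poly M}).

Lemma pdef_size_eq (F : family) n : pdef F ->
  qfdef (fun M e _ => size (F M e) = n.+1).
Proof.
move=> [[N FN] FP].
have c0 i : qfdef (fun (M : acvf p q) e _ => (F M e)`_i = 0) by apply: qfdef_feq0.
have hi : qfdef (fun (M : acvf p q) e _ =>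
    forall i, (i < N)%N -> (n < i)%N -> (F M e)`_i = 0).
  apply: (qfd_all_lt (F := fun i (M : acvf p q) e _ => (n < i)%N -> (F M e)`_i = 0)).
  move=> i _; have [ni|ni] := boolP (n < i)%N.
    by apply: qfdef_ext (c0 i) => M e _; split=> [->|/(_ isT)].
  by apply: qfdef_ext (qfd_const _ True) => M e _; split.
apply: qfdef_ext (qfd_and (qfd_not (c0 n)) hi) => M e _; split.
  move=> [/eqP Fn Fi]; apply/eqP; rewrite eqn_leq; apply/andP; split.
    apply/leq_sizeP => i ni; have [iN|Ni] := ltnP i N; first exact: Fi.
    by rewrite nth_default // (leq_trans (FN M e)).
  by rewrite ltnNge; apply: contra Fn => /leq_sizeP->.
move=> sF; split=> [|i _ ni]; last by rewrite nth_default // sF.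
by apply/eqP; rewrite -[n]/(n.+1.-1) -sF -lead_coefE lead_coef_eq0
  -size_poly_gt0 sF.
Qed.

Lemma pdef_uniform s (R : nat -> family) : (forall i, pdef (R i)) ->
  exists N, forall i, (i < s)%N -> forall M e, (size (R i M e) <= N)%N.
Proof.
move=> RP; elim: s => [|s [N NP]]; first by exists 0%N.
have [[n nP] _] := RP s; exists (maxn N n) => i.
rewrite ltnS leq_eqVlt => /orP[/eqP->|/NP NiP] M e.
  by rewrite leq_max nP orbT.
by rewrite leq_max NiP.
Qed.

Variables (Q : family) (R : nat -> family) (s d N : nat).
Hypothesis QP : pdef Q.
Hypothesis RP : forall i, pdef (R i).
Hypothesis RN : forall i, (i < s)%N -> forall (M : acvf p q) (e : nat -> M),
  (size (R i e) <= N.+1)%N.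

Let lc (M : acvf p q) (e : nat -> M) := (Q e)`_d.+1.

(** Index 0 is the constant form, whose variable will carry the truncation level. The power of [lc]
    at the other indices is the price of the division-free [form_matrix], the value of this form at
    the companion matrix. *)
Definition scaled_form i : family := fun M e =>
  if i is j.+1 then lc e ^+ N *: R j e else 1.

Definition form_matrix i (M : acvf p q) (e : nat -> M) : 'M[M]_d.+1 :=
  if i is j.+1 then
    \sum_(l < N.+1) ((R j e)`_l * lc e ^+ (N - l)) *:
      scaled_companion (Q e) d ^+ l
  else 1.

Lemma mdef_form_matrix i : mdef (form_matrix i).
Proof.
have lcP : tdef (fun (M : acvf p q) e => lc e) by exact: QP.2.
have compP : mdef (fun (M : acvf p q) e => scaled_companion (Q e) d).
  move=> a b; have [ad|ad] := boolP (a == d :> nat).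
    by apply: tdef_ext (tdef_opp (QP.2 b)) => M e; rewrite mxE ad.
  by apply: tdef_ext (tdef_mulrn (a.+1 == b) lcP) => M e; rewrite mxE (negPf ad).
case: i => [|j] a b.
  by apply: tdef_ext (tdef_mulrn (a == b) (@tdef_1 p q)) => M e; rewrite mxE.
pose F (l : 'I_N.+1) (M : acvf p q) (e : nat -> M) :=
  ((R j e)`_l * lc e ^+ (N - l)) * (scaled_companion (Q e) d ^+ l) a b.
have FP l : tdef (F l).
  apply: tdef_mul; last exact: mdef_exp.
  by apply: tdef_mul; [apply: (RP j).2 | apply: tdef_exp].
apply: tdef_ext (tdef_sum _ FP) => M e.
by rewrite summxE; apply: eq_bigr => l _; rewrite mxE.
Qed.

(* The product of the forms attached to the roots of [Q], where the variable
   [U_i] is replaced by the power [B ^ i] of one variable, [B] exceeding the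
   number of roots; the leading coefficient of [Q] clears the denominators of
   the companion matrix. *)
Definition resolvent : family := fun M e =>
  \det (\matrix_(a < d.+1, b < d.+1)
    \sum_(i < s.+1) (form_matrix i e a b)%:P * 'X^(d.+2 ^ i)).

Lemma pdef_resolvent : pdef resolvent.
Proof.
apply: pdef_det => a b.
pose F (i : 'I_s.+1) (M : acvf p q) (e : nat -> M) : {poly M} :=
  (form_matrix i e a b)%:P * 'X^(d.+2 ^ i).
have FP i : pdef (F i).
  apply: pdef_mul; first by apply: pdefC; apply: mdef_form_matrix.
  by apply: pdef_exp; apply: pdefX.
by apply: pdef_ext (pdef_sum _ FP) => M e; rewrite mxE.
Qed.

(** Once the formal variable is evaluated at [t], the matrix is the value at [A] of a single
    polynomial [S], and [det_horner_mx] applies. *)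
Lemma resolvent_roots (M : acvf p q) (e : nat -> M) rs :
    size (Q e) = d.+2 ->
    Q e = lead_coef (Q e) *: \prod_(a <- rs) ('X - a%:P) ->
  resolvent e = \prod_(k < d.+1)
    \sum_(i < s.+1) (scaled_form i e).[rs`_k] *: 'X^(d.+2 ^ i).
Proof.
move=> Qd Qrs; have closedM := @acvf_closed _ _ M.
have lcE : lead_coef (Q e) = lc e by rewrite lead_coefE Qd.
have lc0 : lc e != 0 by rewrite -lcE lead_coef_eq0 -size_poly_gt0 Qd.
have srs : size rs = d.+1.
  move: Qd; rewrite Qrs size_scale ?lcE // size_prod_XsubC.
  by case.
pose A := (lc e)^-1 *: scaled_companion (Q e) d.
have charA : char_poly A = \prod_(a <- rs) ('X - a%:P).
  rewrite char_poly_scaled_companion // -/(lc e) {1}Qrs lcE scalerA mulVf //.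
  by rewrite scale1r.
have formE i : (i < s.+1)%N -> form_matrix i e = horner_mx A (scaled_form i e).
  case: i => [|j] js; first by rewrite /= rmorph1.
  by rewrite /= horner_mx_scaled // RN.
apply: (poly_ext closedM) => t.
pose S := \sum_(i < s.+1) t ^+ (d.+2 ^ i) *: scaled_form i e.
have -> : (resolvent e).[t] = \det (horner_mx A S).
  rewrite -/(horner_eval t _) /resolvent -det_map_mx; congr (\det _).
  rewrite linear_sum; apply/matrixP => a b; rewrite !mxE summxE /=.
  rewrite /horner_eval horner_sum; apply: eq_bigr => i _.
  by rewrite linearZ /= mxE -formE // hornerM hornerC hornerXn mulrC.
rewrite (det_horner_mx closedM _ charA) horner_prod (big_nth 0) big_mkord srs.
apply: eq_bigr => k _; rewrite !horner_sum; apply: eq_bigr => i _.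
by rewrite !hornerZ hornerXn mulrC.
Qed.

Lemma val_scaled_form (M : acvf p q) (e : nat -> M) i a :
  vf_val (scaled_form i.+1 e).[a] =
  eadd (nmul N (vf_val (lc e))) (vf_val (R i e).[a]).
Proof. by rewrite hornerZ valM valX. Qed.

(** The family [w] is a flattened table, with rows of length [s] indexed by the roots; the added
    column 0 will hold [v 1]. *)
Definition coordinate T (x0 : T) (w : nat -> T) k i :=
  if i is j.+1 then w (k * s + j)%N else x0.

Definition tropical_eq_at n (M : acvf p q) (e : nat -> M)
    (w u : nat -> option (vf_group M)) :=
  \big[@emin _/None]_(m < n)
    eadd (vf_val (resolvent e)`_m)
         (\big[@eadd _/Some 0]_(i < s.+1) nmul (digit d.+2 i m) (u i)) =
  \big[@eadd _/Some 0]_(k < d.+1) \big[@emin _/None]_(i < s.+1)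
    eadd (u i) (coordinate (Some 0) w k i).

Definition tropical_eq n (M : acvf p q) (e : nat -> M)
    (w : nat -> option (vf_group M)) := forall u, tropical_eq_at n e w u.

Lemma qfdef_tropical_eq n : qfdef (@tropical_eq n).
Proof.
apply: (qfdef_allf (Q := @tropical_eq_at n)); apply: qfdef_eq.
  apply: (gdef_bigmin (f := fun m (M : acvf p q) e g =>
    eadd (vf_val (resolvent e)`_m) (\big[@eadd _/Some 0]_(i < s.+1)
      nmul (digit d.+2 i m) (odds g i)))) => m _.
  apply: gdef_add; first by apply: gdef_val; apply: pdef_resolvent.2.
  apply: (gdef_bigadd (f := fun i (M : acvf p q) e g =>
    nmul (digit d.+2 i m) (odds g i))) => i _.
  by apply: gdef_nmul; apply: gdef_var.
apply: (gdef_bigadd (f := fun k (M : acvf p q) e g =>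
  \big[@emin _/None]_(i < s.+1)
    eadd (odds g i) (coordinate (Some 0) (evens g) k i))) => k _.
apply: (gdef_bigmin (f := fun i (M : acvf p q) e g =>
  eadd (odds g i) (coordinate (Some 0) (evens g) k i))) => i _.
apply: gdef_add; first exact: gdef_var.
by case: i => [|j]; [apply: gdef_0 | apply: gdef_var].
Qed.

Lemma tropical_eq_roots n (M : acvf p q) (e : nat -> M) rs w :
    (size (resolvent e) <= n)%N -> size (Q e) = d.+2 ->
    Q e = lead_coef (Q e) *: \prod_(a <- rs) ('X - a%:P) ->
  (forall k i, (i < s)%N ->
     w (k * s + i)%N = vf_val (scaled_form i.+1 e).[rs`_k]) ->
  tropical_eq n e w.
Proof.
move=> Rn Qd Qrs wE u; rewrite /tropical_eq_at (resolvent_roots Qd Qrs) in Rn *.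
have := @tropical_product M (@acvf_closed _ _ M) d.+2 d.+1 s.+1 n
  (fun k i => (scaled_form i e).[rs`_k]) u isT (ltnSn _) Rn => ->.
apply: eq_bigr => k _; apply: eq_bigr => -[[|i] i_s] _ /=.
  by rewrite hornerC val1.
by rewrite wE.
Qed.

Lemma tropical_eq_fmin n (M : acvf p q) (e : nat -> M) w w' :
    tropical_eq n e w -> tropical_eq n e w' ->
  forall t (u : 'I_s -> option (vf_group M)),
  \sum_(k < d.+1) fmin t (form u [ffun i : 'I_s => w (k * s + i)%N]) =
  \sum_(k < d.+1) fmin t (form u [ffun i : 'I_s => w' (k * s + i)%N]).
Proof.
move=> wP w'P t u.
(* Giving U_0 the value [t] turns each inner minimum into a truncated form. *)
pose z i := if i is j.+1 then oapp u None (insub j) else Some t.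
have formE x : \big[@eadd _/Some 0]_(k < d.+1) \big[@emin _/None]_(i < s.+1)
      eadd (z i) (coordinate (Some 0) x k i) =
    Some (\sum_(k < d.+1) fmin t (form u [ffun i : 'I_s => x (k * s + i)%N])).
  rewrite -bigeadd_Some; apply: eq_bigr => k _.
  rewrite big_ord_recl /= addr0 -emin_fmin; congr emin.
  by apply: eq_bigr => i _; rewrite /= /bump /= ffunE valK.
by apply: Some_inj; rewrite -!formE -wP -w'P.
Qed.

(** A table that satisfies [tropical_eq] has the rows of the true table [w'] up to order, so a row
    matching [h] belongs to an actual root. Conversely [w'] itself is a witness. *)
Lemma qfdef_root : qfdef (fun M e h => size (Q e) = d.+2 /\
  exists2 a, root (Q e) a &
    forall i, (i < s)%N -> vf_val (R i e).[a] = h i).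
Proof.
have [[n nP] _] := pdef_resolvent.
have matchP : qfdef2 (fun (M : acvf p q) e h w => tropical_eq n e w /\
    exists2 k, (k < d.+1)%N & forall i, (i < s)%N ->
      w (k * s + i)%N = eadd (nmul N (vf_val (lc e))) (h i)).
  apply: qfd_and; first exact: qfdef2_right (qfdef_tropical_eq n).
  apply: (qfd_ex_lt (F := fun k (M : acvf p q) e g => forall i, (i < s)%N ->
    odds g (k * s + i)%N = eadd (nmul N (vf_val (lc e))) (evens g i))) => k _.
  apply: (qfd_all_lt (F := fun i (M : acvf p q) e g =>
    odds g (k * s + i)%N = eadd (nmul N (vf_val (lc e))) (evens g i))) => i _.
  apply: qfdef_eq; first exact: gdef_var.
  apply: gdef_add; last exact: gdef_var.
  by apply/gdef_nmul/gdef_val/QP.2.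
apply: qfdef_ext (qfd_and (pdef_size_eq d.+1 QP) (qfdef_exf matchP)) => M e h.
have [rs Qrs] := closed_split (@acvf_closed _ _ M) (Q e).
pose w' j := vf_val (scaled_form (j %% s).+1 e).[rs`_(j %/ s)].
have w'E k i : (i < s)%N ->
    w' (k * s + i)%N = vf_val (scaled_form i.+1 e).[rs`_k].
  move=> i_s; rewrite /w' modnMDl modn_small // divnMDl ?divn_small ?addn0 //.
  exact: leq_ltn_trans i_s.
have trop Qd := tropical_eq_roots (nP M e) Qd Qrs w'E.
have srs : size (Q e) = d.+2 -> size rs = d.+1.
  move=> Qd; move: (Qd); rewrite Qrs size_scale ?size_prod_XsubC; first by case.
  by rewrite lead_coef_eq0 -size_poly_gt0 Qd.
have rootE a : size (Q e) = d.+2 -> root (Q e) a = (a \in rs).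
  move=> Qd; rewrite Qrs rootZ ?root_prod_XsubC //.
  by rewrite lead_coef_eq0 -size_poly_gt0 Qd.
(* A leading coefficient is nonzero, hence of finite valuation, and the shift of the rows can be
   undone. *)
have cancel_lc (x y : option (vf_group M)) : size (Q e) = d.+2 ->
    eadd (nmul N (vf_val (lc e))) x = eadd (nmul N (vf_val (lc e))) y -> x = y.
  move=> Qd; case E: (vf_val (lc e)) => [g|].
    by rewrite nmulE; apply: eadd_SomeI.
  move/eqP: E; rewrite val_eq0 /lc -[d.+1]/(d.+2.-1) -Qd -lead_coefE.
  by rewrite lead_coef_eq0 -size_poly_eq0 Qd.
split=> [[Qd [w [wP [k kd wk]]]]|[Qd [a ra aP]]]; split=> //.
  have sums := tropical_eq_fmin wP (trop Qd).
  pose vec x k : {ffun 'I_s -> option (vf_group M)} :=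
    [ffun i : 'I_s => x (k * s + i)%N].
  have pe : perm_eq (map (vec w) (iota 0 d.+1)) (map (vec w') (iota 0 d.+1)).
    apply: (forms_determine_vectors (acvf_pos M)); first by rewrite !size_map.
    move=> t u; rewrite !big_map -[iota 0 d.+1]/(index_iota 0 d.+1) !big_mkord.
    exact: sums.
  have : vec w k \in map (vec w') (iota 0 d.+1).
    by rewrite -(perm_mem pe) map_f // mem_iota.
  case/mapP => k'; rewrite mem_iota add0n => /andP[_ k'd] vecE.
  exists rs`_k'; first by rewrite rootE // mem_nth // srs.
  move=> i i_s; have := congr1 (fun f : {ffun _ -> _} => f (Ordinal i_s)) vecE.
  by rewrite !ffunE /= w'E // wk // val_scaled_form => /(cancel_lc _ _ Qd).
exists w'; split; first exact: trop.
rewrite rootE // in ra; exists (index a rs); first by rewrite -srs ?index_mem.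
by move=> i i_s; rewrite w'E // nth_index // val_scaled_form aP.
Qed.

End RootElimination.

(** * Quantifiers over the field *)

Section FieldElimination.
Variables p q : nat.
Local Notation family := (forall M : acvf p q, (nat -> M) -> {poly M}).

Lemma qfdef_ex_values (P : nat -> family) n : (forall j, pdef (P j)) ->
  qfdef (fun M e h => exists x, forall j, (j < n)%N ->
    vf_val (P j M e).[x] = h j).
Proof.
move=> PP; have [N PN] := pdef_uniform n PP.
(* One list for all divided derivatives: that of order [m] of [P j] stands at position
   [j * N + m]. *)
pose R i : family := fun M e => (P (i %/ N)%N M e)^`N(i %% N).
have RP i : pdef (R i) by apply/pdef_nderivn/PP.
have RE j m (M : acvf p q) (e : nat -> M) : (m < N)%N ->
    R (j * N + m)%N M e = (P j M e)^`N(m).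
  move=> mN; rewrite /R modnMDl modn_small // divnMDl ?divn_small ?addn0 //.
  exact: leq_ltn_trans mN.
have [N' RN] := pdef_uniform (n * N) RP.
have RN' i : (i < n * N)%N -> forall (M : acvf p q) (e : nat -> M),
    (size (R i M e) <= N'.+1)%N by move=> iN M e; apply/leqW/RN.
(* If every [P j] is constant there is no root to serve as a center, so that case is kept apart. *)
pose nonconst (M : acvf p q) (e : nat -> M) (h : nat -> option (vf_group M)) :=
  exists2 j, (j < n)%N & exists2 d, (d < N)%N & size (P j M e) = d.+2.
have nonconstP : qfdef nonconst.
  apply: (qfd_ex_lt (F := fun j (M : acvf p q) e _ =>
    exists2 d, (d < N)%N & size (P j M e) = d.+2)) => j _.
  apply: (qfd_ex_lt (F := fun d (M : acvf p q) e _ =>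
    size (P j M e) = d.+2)) => d _.
  exact: pdef_size_eq.
pose const_case (M : acvf p q) (e : nat -> M) h :=
  forall j, (j < n)%N -> vf_val (P j M e)`_0 = h j.
have constP : qfdef const_case.
  apply: (qfd_all_lt (F := fun j (M : acvf p q) e h =>
    vf_val (P j M e)`_0 = h j)) => j _.
  by apply: qfdef_eq; [apply/gdef_val/(PP j).2 | apply: gdef_var].
(* The entries of [z] below [n * N] are the valuations of the derivatives at the center [a]; the
   entry at [n * N] is the radius. *)
pose root_case j d (M : acvf p q) (e : nat -> M) h z :=
  (size (P j M e) = d.+2 /\ exists2 a, root (P j M e) a &
    forall i, (i < n * N)%N -> vf_val (R i M e).[a] = z i) /\
  forall i, (i < n)%N -> \big[@emin _/None]_(m < N)
    eadd (z (i * N + m)%N) (nmul m (z (n * N)%N)) = h i.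
have rootP j d : qfdef2 (root_case j d).
  apply: qfd_and; first exact: qfdef2_right (qfdef_root d (PP j) RP RN').
  apply: (qfd_all_lt (F := fun i (M : acvf p q) e g =>
    \big[@emin _/None]_(m < N)
      eadd (odds g (i * N + m)%N) (nmul m (odds g (n * N)%N)) = evens g i)) => i _.
  apply: qfdef_eq; last exact: gdef_var.
  apply: (gdef_bigmin (f := fun m (M : acvf p q) e g =>
    eadd (odds g (i * N + m)%N) (nmul m (odds g (n * N)%N)))) => m _.
  by apply: gdef_add; [apply: gdef_var | apply/gdef_nmul/gdef_var].
have rootsP : qfdef (fun M e h => exists2 j, (j < n)%N &
    exists2 d, (d < N)%N & exists z, root_case j d M e h z).
  apply: (qfd_ex_lt (F := fun j (M : acvf p q) e h =>
    exists2 d, (d < N)%N & exists z, root_case j d M e h z)) => j _.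
  apply: (qfd_ex_lt (F := fun d (M : acvf p q) e h =>
    exists z, root_case j d M e h z)) => d _.
  exact: qfdef_exf.
apply: qfdef_ext (qfd_or (qfd_and (qfd_not nonconstP) constP) rootsP) => M e h.
have ball_root j a c z : (j < n)%N ->
    (forall i, (i < n * N)%N -> vf_val (R i M e).[a] = z i) ->
    z (n * N)%N = vf_val c ->
    \big[@emin _/None]_(m < N) eadd (z (j * N + m)%N) (nmul m (z (n * N)%N)) =
    ball_min N (P j M e) a (vf_val c).
  move=> jn zE zc; apply: eq_bigr => m _; rewrite zc -zE ?RE //.
  apply: leq_trans (_ : (j.+1 * N <= _)%N); last by rewrite leq_mul2r jn orbT.
  by rewrite mulSn addnC ltn_add2r.
have constE j x : (j < n)%N -> ~ nonconst M e h -> (P j M e).[x] = (P j M e)`_0.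
  move=> jn ncst; have [sj|] := leqP (size (P j M e)) 1.
    by rewrite [in LHS](size1_polyC sj) hornerC.
  case sj: (size (P j M e)) => [|[|d]] // _; case: ncst; exists j => //.
  by exists d => //; have := PN j jn M e; rewrite sj; apply: leq_trans.
split=> [[[ncst cst]|[j jn [d dN [z [[sj [a ra zE] hE]]]]]]|[x xE]].
- by exists 0 => j jn; rewrite constE // cst.
- have [c cE] := val_surj (v := acvf_vf M) (z (n * N)%N).
  have [x xE] := ball_values (@acvf_closed _ _ M) a c (fun j jn => PN j jn M e).
  by exists x => i i_n; rewrite xE // -hE // (ball_root _ a c).
have [[j0 j0n [d0 d0N sj0]]|ncst] := classic (nonconst M e h); last first.
  by left; split=> // j jn; rewrite -xE // constE.
right; have [|j [a [c [jn sj ra aE]]]] :=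
    closest_root (@acvf_closed _ _ M) x (fun j jn => PN j jn M e).
  by exists j0 => //; rewrite sj0.
have sjN := PN j jn M e.
exists j => //; exists (size (P j M e)).-2.
  by case: (size _) sj sjN => [|[|d]] //= _; apply: leq_trans.
pose z i := if (i == n * N)%N then vf_val c else vf_val (R i M e).[a].
have zE i : (i < n * N)%N -> vf_val (R i M e).[a] = z i.
  by rewrite /z ltn_neqAle => /andP[/negPf->].
exists z; split; last first.
  by move=> i i_n; rewrite (ball_root _ a c) ?/z ?eqxx // -aE // xE.
split; last by exists a.
by case: (size _) sj => [|[|d]].
Qed.

(** * Replacing field terms by variables for their valuations *)

Fixpoint fpoly i (K : fieldType) (e : nat -> K) t : {poly K} :=
  match t with
  | FVar j => if j == i then 'X else (e j)%:P
  | FZero => 0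
  | FOne => 1
  | FAdd s t => fpoly i e s + fpoly i e t
  | FSub s t => fpoly i e s - fpoly i e t
  | FMul s t => fpoly i e s * fpoly i e t
  end.

Lemma horner_fpoly i (M : acvf p q) (e : nat -> M) t x :
  (fpoly i e t).[x] = feval (update e i x) t.
Proof.
elim: t => [j|||s IHs t IHt|s IHs t IHt|s IHs t IHt] /=.
- by rewrite /update; case: eqP => _; rewrite (hornerX, hornerC).
- by rewrite horner0.
- by rewrite hornerC.
- by rewrite hornerD IHs IHt.
- by rewrite hornerD hornerN IHs IHt.
- by rewrite hornerM IHs IHt.
Qed.

Lemma pdef_fpoly i t : @pdef p q (fun M e => fpoly i e t).
Proof.
elim: t => [j|||s IHs t IHt|s IHs t IHt|s IHs t IHt] /=.
- case: eqP => _; first exact: pdefX.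
  by apply: pdefC; exists (FVar j).
- by apply: pdef_ext (pdefC (@tdef_0 p q)).
- by apply: pdef_ext (pdefC (@tdef_1 p q)).
- exact: pdef_add.
- exact/pdef_add/pdef_opp.
- exact: pdef_mul.
Qed.

(** The offset [m] lets the lists of two subformulas be concatenated. *)
Definition abstracted m Ps (M : acvf p q) (e : nat -> M)
    (z : nat -> option (vf_group M)) :=
  forall j, (j < size Ps)%N -> z (m + j)%N = vf_val (feval e (nth FZero Ps j)).

Lemma abstracted_cat m Ps Rs (M : acvf p q) (e : nat -> M) z :
  abstracted m (Ps ++ Rs) e z ->
  abstracted m Ps e z /\ abstracted (m + size Ps) Rs e z.
Proof.
move=> zE; split=> j js.
  by rewrite zE ?size_cat ?ltn_addr // nth_cat js.
by rewrite -addnA zE ?size_cat ?ltn_add2l // nth_cat ltnNge leq_addr addKn.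
Qed.

Lemma interleave_odd T (h z : nat -> T) i : interleave h z i.*2.+1 = z i.
Proof. by rewrite -[in RHS](odds_interleave h z). Qed.

Lemma interleave_even T (h z : nat -> T) i : interleave h z i.*2 = h i.
Proof. by rewrite -[in RHS](evens_interleave h z). Qed.

Lemma abstract_gterm t m : exists Ps u, forall (M : acvf p q) (e e' : nat -> M) h z,
  abstracted m Ps e z -> geval e' (interleave h z) u = geval e h t.
Proof.
elim: t m => [i|||s IHs t IHt|s IHs t IHt|n t IHt|t] m.
- by exists [::], (GVar i.*2) => M e e' h z _ /=; rewrite interleave_even.
- by exists [::], GZero.
- by exists [::], GInfty.
- have [Ps [u uP]] := IHs m; have [Rs [w wP]] := IHt (m + size Ps)%N.
  exists (Ps ++ Rs), (GAdd u w) => M e e' h z /abstracted_cat[Pz Rz] /=.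
  by rewrite (uP M e) // (wP M e).
- have [Ps [u uP]] := IHs m; have [Rs [w wP]] := IHt (m + size Ps)%N.
  exists (Ps ++ Rs), (GSub u w) => M e e' h z /abstracted_cat[Pz Rz] /=.
  by rewrite (uP M e) // (wP M e).
- have [Ps [u uP]] := IHt m; exists Ps, (GDiv n u) => M e e' h z Pz /=.
  by rewrite (uP M e).
- exists [:: t], (GVar m.*2.+1) => M e e' h z /(_ 0%N isT).
  by rewrite addn0 /= => <-; rewrite interleave_odd.
Qed.

(** A field equation [s = t] becomes [v (s - t) = infinity], so no field variable survives in [g];
    this is why its field environment [e'] is arbitrary. *)
Lemma abstract_formula f m : quantifier_free f ->
  exists Ps g, quantifier_free g /\
  forall (M : acvf p q) (e e' : nat -> M) h z, abstracted m Ps e z ->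
    (holds e' (interleave h z) g <-> holds e h f).
Proof.
elim: f m => //=.
- move=> s t m _; exists [:: FSub s t], (GEq (GVar m.*2.+1) GInfty); split=> //.
  move=> M e e' h z /(_ 0%N isT); rewrite addn0 /= interleave_odd => ->.
  by rewrite val_eq_infty; split=> [/eqP|->]; rewrite ?subrr // subr_eq0 => /eqP.
- move=> s t m _; have [Ps [u uP]] := abstract_gterm s m.
  have [Rs [w wP]] := abstract_gterm t (m + size Ps)%N.
  exists (Ps ++ Rs), (GEq u w); split=> // M e e' h z /abstracted_cat[Pz Rz] /=.
  by rewrite (uP M e) // (wP M e).
- move=> s t m _; have [Ps [u uP]] := abstract_gterm s m.
  have [Rs [w wP]] := abstract_gterm t (m + size Ps)%N.
  exists (Ps ++ Rs), (GLt u w); split=> // M e e' h z /abstracted_cat[Pz Rz] /=.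
  by rewrite (uP M e) // (wP M e).
- by move=> m _; exists [::], Bot.
- move=> f IH m /(IH m)[Ps [g [qg gP]]].
  by exists Ps, (Not g); split=> // M e e' h z Pz /=; rewrite (gP M e).
- move=> f1 IH1 f2 IH2 m /andP[/(IH1 m)[Ps [g1 [q1 g1P]]]].
  move=> /(IH2 (m + size Ps)%N)[Rs [g2 [q2 g2P]]].
  exists (Ps ++ Rs), (And g1 g2); split=> [|M e e' h z]; first by rewrite /= q1.
  by case/abstracted_cat=> Pz Rz /=; rewrite (g1P M e) // (g2P M e).
- move=> f1 IH1 f2 IH2 m /andP[/(IH1 m)[Ps [g1 [q1 g1P]]]].
  move=> /(IH2 (m + size Ps)%N)[Rs [g2 [q2 g2P]]].
  exists (Ps ++ Rs), (Or g1 g2); split=> [|M e e' h z]; first by rewrite /= q1.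
  by case/abstracted_cat=> Pz Rz /=; rewrite (g1P M e) // (g2P M e).
- move=> f1 IH1 f2 IH2 m /andP[/(IH1 m)[Ps [g1 [q1 g1P]]]].
  move=> /(IH2 (m + size Ps)%N)[Rs [g2 [q2 g2P]]].
  exists (Ps ++ Rs), (Imp g1 g2); split=> [|M e e' h z]; first by rewrite /= q1.
  by case/abstracted_cat=> Pz Rz /=; rewrite (g1P M e) // (g2P M e).
Qed.

Lemma interleaveK T (g : nat -> T) : interleave (evens g) (odds g) = g.
Proof.
apply: functional_extensionality => i; rewrite /interleave /evens /odds.
by have := odd_double_half i; case: (odd i) => /= E; rewrite -[in RHS]E.
Qed.

Lemma qfdef_fex i (P : relation p q) : qfdef P ->
  qfdef (fun M e h => exists x, P M (update e i x) h).
Proof.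
move=> [f [qf fP]]; have [Ps [g [qg gP]]] := abstract_formula 0 qf.
have valP := qfdef_ex_values (P := fun j (M : acvf p q) e =>
  fpoly i e (nth FZero Ps j)) (size Ps) (fun j => pdef_fpoly i _).
have gP2 : qfdef2 (fun (M : acvf p q) e h z => holds e (interleave h z) g).
  by apply: qfdef_ext (qfd_formula _ qg) => M e h; rewrite interleaveK.
pose Q (M : acvf p q) (e : nat -> M) h z :=
  (exists x, forall j, (j < size Ps)%N ->
     vf_val (fpoly i e (nth FZero Ps j)).[x] = z j) /\
  holds e (interleave h z) g.
have QP : qfdef2 Q by apply: qfd_and (qfdef2_right valP) gP2.
apply: qfdef_ext (qfdef_exf QP) => M e h.
have absP x z : (forall j, (j < size Ps)%N ->
    vf_val (fpoly i e (nth FZero Ps j)).[x] = z j) ->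
    abstracted 0 Ps (update e i x) z.
  by move=> zE j js; rewrite add0n -zE // horner_fpoly.
split=> [[z [[x /absP xz] zg]]|[x xP]].
  by exists x; apply/fP => //; apply/(gP _ _ e _ _ xz).
exists (fun j => vf_val (fpoly i e (nth FZero Ps j)).[x]); split.
  by exists x.
by apply/(gP M (update e i x)); [apply: absP | apply/fP].
Qed.

Lemma qfdef_formula phi : qfdef (fun (M : acvf p q) e h => holds e h phi).
Proof.
elim: phi => /=.
- by move=> s t; apply: (qfd_formula _ (phi := FEq s t)).
- by move=> s t; apply: (qfd_formula _ (phi := GEq s t)).
- by move=> s t; apply: (qfd_formula _ (phi := GLt s t)).
- exact: qfd_False.
- by move=> f; apply: qfd_not.
- by move=> f IHf g IHg; apply: qfd_and.
- by move=> f IHf g IHg; apply: qfd_or.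
- move=> f IHf g IHg; apply: qfdef_ext (qfd_or (qfd_not IHf) IHg) => M e h.
  by have := classic (holds e h f); tauto.
- by move=> i f; apply: qfdef_fex.
- move=> i f IH; apply: qfdef_ext (qfd_not (qfdef_fex i (qfd_not IH))) => M e h.
  split=> [nex x|all [x]]; last exact.
  by apply: NNPP => nx; apply: nex; exists x.
- by move=> i f; apply: qfdef_gex.
- move=> i f IH; apply: qfdef_ext (qfd_not (qfdef_gex i (qfd_not IH))) => M e h.
  split=> [nex x|all [x]]; last exact.
  by apply: NNPP => nx; apply: nex; exists x.
Qed.

End FieldElimination.

Theorem theorem3p1 (p q : nat) (Hpq : possible_characteristics p q)
    (phi : formula) :
  exists psi : formula, quantifier_free psi /\ acvf_equivalent p q phi psi.
Proof.
have [psi [qpsi psiP]] := qfdef_formula p q phi.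
by exists psi; split=> // M e h; rewrite psiP.
Qed.
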